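(* Let $M=\begin{pmatrix}A&B\\C&D\end{pmatrix}$ be a matrix with integer coefficients such that $|\det(M)|=1$. Assume that $M$ admits an eigenvalue $\lambda$ with modulus $|\lambda|>1$, and let $(\alpha,\beta)$ be the eigenvector associated to $\lambda$ such that $\alpha+\beta=1$. For every pair of integers $(n,m)$, let $$\gamma=\frac{\alpha}{\lambda-\det(M)}\left(n-\frac{AC}{2}\right)+\frac{\beta}{\lambda-\det(M)}\left(m-\frac{BD}{2}\right).$$ Then the niltranslation by the element $\left[\alpha,\ \beta,\ \gamma+\frac{\alpha\beta}{2}\right]$ on the nilmanifold $$\left\{[x,\,-x+k,\,z]\ ;\ (x,z)\in\mathbb R^2,\ k\in\mathbb Z\right\}\Big/\left\{[i,j,p]\ ;\ (i,j,p)\in\mathbb Z^3\right\}$$ is self-induced, minimal and uniquely ergodic.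
   Context: $\boldsymbol X=\mathbb H_3(\mathbb R)$ is the Heisenberg group of real upper triangular $3\times3$ matrices with $1$'s on the diagonal. The matrix $\begin{pmatrix}1&x&z\\0&1&y\\0&0&1\end{pmatrix}$ is written $[x,y,z]$, so $[x,y,z]\bullet[x',y',z']=[x+x',y+y',z+z'+xy']$. Let $\boldsymbol\Gamma=\{[i,j,p]:(i,j,p)\in\mathbb Z^3\}$. The displayed nilmanifold is the quotient of the subgroup $\{[x,y,z]:x+y\in\mathbb Z\}$ by right multiplication by $\boldsymbol\Gamma$ (the set of cosets $\boldsymbol x\bullet\boldsymbol\Gamma$). The niltranslation by $\boldsymbol g$ is the map $\boldsymbol x\bullet\boldsymbol\Gamma\mapsto\boldsymbol g\bullet\boldsymbol x\bullet\boldsymbol\Gamma$; it preserves this nilmanifold when $\boldsymbol g=[\alpha,\beta,\cdot]$ with $\alpha+\beta=1$. The nilmanifold carries its invariant (Haar) probability measure $\mu$. A measure-preserving system $(Y,T,\mu)$ is called self-induced if there is a measurable subset $A\subset Y$ with $0<\mu(A)<\mu(Y)$ such that the first return map of $T$ to $A$ (defined by $T_A(y)=T^{n(y)}(y)$ with $n(y)=\min\{n\ge1:T^n(y)\in A\}$), equipped with the normalized restriction of $\mu$ to $A$, is measurably conjugate to $(Y,T,\mu)$ with $\mu$ normalized, i.e. conjugate by a bi-measurable, measure-preserving bijection defined up to null sets. *)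

(* Defs.v *)
From HB Require Import structures.
From mathcomp Require Import all_boot all_order all_algebra.
From mathcomp Require Import all_classical all_reals all_analysis.
From mathcomp Require Import ring.

Set Implicit Arguments.
Unset Strict Implicit.
Unset Printing Implicit Defensive.

Import Order.TTheory GRing.Theory Num.Theory.
Import numFieldNormedType.Exports.

Local Open Scope classical_set_scope.
Local Open Scope quotient_scope.
Local Open Scope ring_scope.

Definition mx2 (T : Type) (a b c d : T) : 'M[T]_2 :=
  \matrix_(i, j) if i == 0 then (if j == 0 then a else b)
                 else (if j == 0 then c else d).

Definition cV2 (T : Type) (a b : T) : 'cV[T]_2 :=
  \col_i if i == 0 then a else b.

(* The element with coordinates (x, y, z) stands for the unitriangular matrix
   heis_mx (x, y, z); see heis_mxM. *)
Definition heis (R : realType) : Type := (R * R * R)%type.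

HB.instance Definition _ (R : realType) :=
  Topological.copy (heis R) (R * R * R)%type.

Definition Heis (R : realType) (x y z : R) : heis R := (x, y, z).

Section HeisenbergGroup.
Variable R : realType.
Implicit Types g h : heis R.

Definition hx g : R := g.1.1.
Definition hy g : R := g.1.2.
Definition hz g : R := g.2.

Definition heis_one : heis R := Heis 0 0 0.
Definition heis_mul g h : heis R :=
  Heis (hx g + hx h) (hy g + hy h) (hz g + hz h + hx g * hy h).
Definition heis_inv g : heis R := Heis (- hx g) (- hy g) (- hz g + hx g * hy g).

Fact heis_mulA : associative heis_mul.
Proof.
move=> [[a b] c] [[a' b'] c'] [[a2 b2] c2]; rewrite /heis_mul /Heis /hx /hy /hz /=.
by congr (_, _, _); ring.
Qed.

Fact heis_mul1 : left_id heis_one heis_mul.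
Proof.
move=> [[a b] c]; rewrite /heis_mul /Heis /hx /hy /hz /=.
by congr (_, _, _); ring.
Qed.

Fact heis_mulr1 : right_id heis_one heis_mul.
Proof.
move=> [[a b] c]; rewrite /heis_mul /Heis /hx /hy /hz /=.
by congr (_, _, _); ring.
Qed.

Fact heis_mulV : left_inverse heis_one heis_inv heis_mul.
Proof.
move=> [[a b] c]; rewrite /heis_mul /heis_inv /Heis /hx /hy /hz /=.
by congr (_, _, _); ring.
Qed.

Fact heis_mulrV : right_inverse heis_one heis_inv heis_mul.
Proof.
move=> [[a b] c]; rewrite /heis_mul /heis_inv /Heis /hx /hy /hz /=.
by congr (_, _, _); ring.
Qed.

HB.instance Definition _ := isGroup.Build (heis R)
  heis_mulA heis_mul1 heis_mulr1 heis_mulV heis_mulrV.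

Definition heis_mx g : 'M[R]_3 :=
  \matrix_(i, j) nth 0 (nth [::] [:: [:: 1; hx g; hz g];
                                     [:: 0; 1; hy g];
                                     [:: 0; 0; 1]] i) j.

Lemma heis_mxM g h : heis_mx (g * h)%g = heis_mx g *m heis_mx h.
Proof.
apply/matrixP => i j; rewrite !mxE !big_ord_recl big_ord0 !mxE /=.
by case: i => -[|[|[|//]]] ?; case: j => -[|[|[|//]]] ? /=;
  rewrite /hx /hy /hz /=; ring.
Qed.

Definition heis_int : {pred heis R} :=
  [pred g | [&& hx g \is a Num.int, hy g \is a Num.int & hz g \is a Num.int]].

Definition slice_pred : {pred heis R} := [pred g | hx g + hy g \is a Num.int].

Fact heis_int_closed : group_closed heis_int.
Proof.
split=> [|g h]; first by rewrite !inE !rpred0.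
rewrite !inE => /and3P[gx gy gz] /and3P[h1 h2 h3].
have hVz : - hz h + hx h * hy h \is a Num.int.
  by rewrite rpredD ?rpredN ?rpredM.
apply/and3P; split; first exact: rpredB.
  exact: rpredB.
have -> : hz (g / h)%g = hz g + (- hz h + hx h * hy h) + hx g * - hy h by [].
by apply: rpredD; [exact: rpredD | apply: rpredM; rewrite ?rpredN].
Qed.

Fact slice_closed : group_closed slice_pred.
Proof.
split=> [|g h]; first by rewrite !inE addr0 rpred0.
rewrite !inE => gP hP.
have -> : hx (g / h)%g + hy (g / h)%g = (hx g + hy g) - (hx h + hy h).
  rewrite -[hx (_ / _)%g]/(hx g - hx h) -[hy (_ / _)%g]/(hy g - hy h); ring.
exact: rpredB.
Qed.

Lemma Heis_slice (x y z : R) : x + y = 1 -> Heis x y z \in slice_pred.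
Proof. by rewrite inE /hx /hy /= => ->; rewrite rpred1. Qed.

End HeisenbergGroup.

Arguments heis_int R : clear implicits.
Arguments slice_pred R : clear implicits.

(* The subgroup {[x, y, z] : x + y an integer} = {[x, -x + k, z]}. *)
Definition slice (R : realType) : Type := {g : heis R | g \in slice_pred R}.

HB.instance Definition _ (R : realType) := SubChoice.on (slice R).
HB.instance Definition _ (R : realType) :=
  SubChoice_isSubGroup.Build _ _ (slice R) (slice_closed R).
HB.instance Definition _ (R : realType) :=
  Topological.copy (slice R) (initial_topology (val : slice R -> heis R)).
HB.instance Definition _ (R : realType) := isPointed.Build (slice R) 1%g.

Section Nilmanifold.
Variable R : realType.
Implicit Types x y : slice R.

Definition coset_eq x y : bool := val (x^-1 * y)%g \in heis_int R.

Fact val_divl x y : val (x^-1 * y)%g = ((val x)^-1 * val y)%g.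
Proof. by []. Qed.

Lemma coset_eqP x y :
  reflect (exists2 w : heis R, w \in heis_int R & val y = (val x * w)%g)
          (coset_eq x y).
Proof.
apply: (iffP idP) => [h|[w wZ e]].
  by exists (val (x^-1 * y)%g) => //; rewrite val_divl mulVKg.
by rewrite /coset_eq val_divl e mulKg.
Qed.

Fact coset_eq_refl : reflexive coset_eq.
Proof. by move=> x; rewrite /coset_eq mulVg; case: (heis_int_closed R). Qed.

Fact coset_eq_trans : transitive coset_eq.
Proof.
move=> y x z /coset_eqP[w wZ yE] /coset_eqP[w' w'Z zE].
apply/coset_eqP; exists (w * w')%g; last by rewrite zE yE mulgA.
have [Z1 ZB] := heis_int_closed R.
have := ZB w (1 / w')%g wZ (ZB _ _ Z1 w'Z).
by rewrite mul1g invgK.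
Qed.

Fact coset_eq_sym : symmetric coset_eq.
Proof.
have [Z1 ZB] := heis_int_closed R.
suff H x y : coset_eq x y -> coset_eq y x by move=> x y; apply/idP/idP; exact: H.
rewrite /coset_eq => h.
have := ZB _ _ Z1 h; rewrite mul1g !val_divl.
by rewrite invgM invgK.
Qed.

Canonical coset_equiv :=
  EquivRel coset_eq coset_eq_refl coset_eq_sym coset_eq_trans.

(* The classes of coset_eq are the cosets of the integer subgroup. *)
Definition nilmanifold : Type := quotient_topology {eq_quot coset_eq}.

HB.instance Definition _ :=
  PointedTopological.copy nilmanifold (quotient_topology {eq_quot coset_eq}).
HB.instance Definition _ :=
  Quotient.copy nilmanifold (quotient_topology {eq_quot coset_eq}).

Definition niltranslation (g : slice R) (q : nilmanifold) : nilmanifold :=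
  \pi_nilmanifold (g * repr q)%g.

Lemma niltranslationE (g x : slice R) :
  niltranslation g (\pi_nilmanifold x) = \pi_nilmanifold (g * x)%g.
Proof.
rewrite /niltranslation; apply/eqmodP => /=.
have : coset_eq (repr (\pi_nilmanifold x)) x by apply/eqmodP; rewrite reprK.
by rewrite /coset_eq invgM -!mulgA mulKg.
Qed.

End Nilmanifold.

Definition borel (T : ptopologicalType) := g_sigma_algebraType (@open T).

Section Dynamics.
Context {R : realType} {d : measure_display} {Y : measurableType d}.
Implicit Types (T : Y -> Y) (A : set Y).

Definition measure_preserving (mu : set Y -> \bar R) T :=
  measurable_fun setT T /\
  forall B, measurable B -> mu (T @^-1` B) = mu B.

Definition is_return_time T A (y : Y) (n : nat) :=
  [/\ (0 < n)%N, A (iter n T y) & forall k, (0 < k < n)%N -> ~ A (iter k T y)].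

Definition return_time T A (y : Y) : nat := xget 0%N (is_return_time T A y).

(* Only its values on return_domain T A are meaningful. *)
Definition first_return T A (y : Y) : Y := iter (return_time T A y) T y.

Definition return_domain T A : set Y :=
  [set y | A y /\ exists n, is_return_time T A y n].

Definition normalized_restriction (mu : set Y -> \bar R) A (B : set Y) : \bar R :=
  (mu (B `&` A) * ((fine (mu A))^-1)%:E)%E.

End Dynamics.

(* Conjugacy, up to null sets, of the system T1 defined on D1 with the system
   T2 defined on D2; D1 and D2 need only have full measure. *)
Definition measurably_conjugate (R : realType)
    (d1 d2 : measure_display) (Y1 : measurableType d1) (Y2 : measurableType d2)
    (D1 : set Y1) (mu1 : set Y1 -> \bar R) (T1 : Y1 -> Y1)
    (D2 : set Y2) (mu2 : set Y2 -> \bar R) (T2 : Y2 -> Y2) :=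
  exists (X1 : set Y1) (X2 : set Y2) (phi : Y1 -> Y2),
    [/\ [/\ measurable X1, X1 `<=` D1, mu1 (~` X1) = 0%E & T1 @` X1 `<=` X1],
        [/\ measurable X2, X2 `<=` D2, mu2 (~` X2) = 0%E & T2 @` X2 `<=` X2],
        set_bij X1 X2 phi,
        (forall B, measurable B -> B `<=` X2 ->
           measurable (X1 `&` phi @^-1` B) /\
           mu1 (X1 `&` phi @^-1` B) = mu2 B) /\
        (forall B, measurable B -> B `<=` X1 -> measurable (phi @` B)) &
        {in X1, forall y, phi (T1 y) = T2 (phi y)}].

Definition self_induced (R : realType) (d : measure_display)
    (Y : measurableType d) (mu : {finite_measure set Y -> \bar R})
    (T : Y -> Y) :=
  measure_preserving mu T /\
  exists A : set Y,
    [/\ measurable A, (0 < mu A)%E, (mu A < mu setT)%E &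
        measurably_conjugate
          (return_domain T A) (normalized_restriction mu A) (first_return T A)
          setT (normalized_restriction mu setT) T].

Definition minimal (Y : topologicalType) (T : Y -> Y) :=
  forall F : set Y, closed F -> F !=set0 -> T @` F `<=` F -> F = setT.

Definition uniquely_ergodic (R : realType) (Y : ptopologicalType) (T : Y -> Y) :=
  exists2 mu : probability (borel Y) R, measure_preserving mu T &
    forall nu : probability (borel Y) R, measure_preserving nu T ->
      forall B : set (borel Y), measurable B -> nu B = mu B.

(* Invariance under all of the subgroup slice R, not only under one element. *)
Definition haar (R : realType) (mu : probability (borel (nilmanifold R)) R) :=
  forall g : slice R, measure_preserving mu (niltranslation g).

(* Main.v *)
Require Import Defs.
From HB Require Import structures.
From mathcomp Require Import all_boot all_order all_algebra.
From mathcomp Require Import all_classical all_reals all_analysis.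
From mathcomp Require Import measurable_realfun ring lra.
Set Implicit Arguments.
Unset Strict Implicit.
Unset Printing Implicit Defensive.
Import Order.TTheory GRing.Theory Num.Theory.
Import numFieldNormedType.Exports.
Local Open Scope classical_set_scope.
Local Open Scope quotient_scope.
Local Open Scope ring_scope.

(** The nilmanifold is a torus.  The functions [x] and
    [w = z - (x + y) * x + x * (x - 1) / 2] on the subgroup change by integers
    under right multiplication by integer elements, and their classes modulo 1
    determine the coset ([coset_eqE]).  In these coordinates the element
    [[a, b, c]] with [a + b = k] acts by
    [(x, w) |-> (x + a, w - k * x + constant)] ([niltranslation_nilF]), so the
    image of the Haar measure of the torus is invariant under the whole group,
    and the niltranslation of the theorem is the skew product
    [(x, w) |-> (x + alpha, w - x + constant)].  Here [alpha] is irrational: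
    if [j * alpha] were an integer, all the numbers [lam ^- n * j] would be
    nonzero integers, because the inverse of the matrix is integral
    ([eigen_irrational]).

    Unique ergodicity and minimality come from one statement about positive,
    normalized, invariant linear functionals [L] on trigonometric polynomials:
    [L] vanishes on every nontrivial character, so there is only one
    ([mean_unique]).  For a character in [x] alone this is the irrationality of
    [alpha].  For a character [f] that involves [w], the product of [f o T ^ h]
    with the conjugate of [f o T ^ k] is a character in [x] alone, so the square
    of [L f], which is at most [L] of the squared modulus of the average of
    [H] translates of [f], is at most [1 / H].  An invariant probability gives
    such a functional by integration, and bounded pointwise limits of
    trigonometric polynomials include the indicators of enough sets to recover
    the measure ([trig_determines]).  The limit along an ultrafilter of the
    averages over the orbit of a point gives another one; if the orbit avoided
    an open set, the step functions concentrated on a box inside that set would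
    have a small value under one functional and not under the other
    ([chart_minimal]).

    For self-induction, the translating element is [flow 1] for a one-parameter
    subgroup [flow], and the special value of [gamma] says that an automorphism
    [N] of the Heisenberg group that extends the matrix and preserves the
    integer elements satisfies [N (flow t) = flow (lam * t)] ([aut_flow]).  The
    subgroup [x + y] integer is a section of the flow with constant return time
    1.  Let [L >= 2] be an even power of [lam] and let [N] denote the same
    iterate of the automorphism.  Applying [N] and then following the flow up to
    the section is a map [expand] of the nilmanifold to itself.  The images
    under [N] of two consecutive points of an orbit are separated by a time
    [L > 1], so the section is crossed between them: [expand] is injective and
    keeps the order along orbits, hence it conjugates the niltranslation with
    its first return map to the image of [expand] ([return_expand]).  That the
    conjugacy respects the measures is not computed: the normalized measure of
    the image, pulled back by [expand], is invariant, so it is the Haar measure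
    by unique ergodicity ([self_induced_of_conjugacy]). *)

(** * Trigonometric polynomials and invariant means of a skew product *)
Section CircleCosine.
Context {R : realType}.
Implicit Types s t a b : R.

Definition cos2pi t := cos (t * (pi *+ 2)).

Lemma cos2piDint s t : t \is a Num.int -> cos2pi (s + t) = cos2pi s.
Proof.
have N n u : cos (u + pi *+ 2 *+ n) = cos u.
  by elim: n u => [|n IH] u; rewrite ?mulr0n ?addr0// mulrSr addrA cosD2pi IH.
move=> /intrP[i ->]; rewrite /cos2pi mulrDl; case: (intP i) => [|n|n].
- by rewrite mul0r addr0.
- by rewrite -pmulrn mulr_natl N.
- by rewrite mulrNz -pmulrn mulNr mulr_natl -[in RHS](subrK (pi *+ 2 *+ n.+1) (s * _)) N.
Qed.

Lemma cos2pi0 : cos2pi 0 = 1.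
Proof. by rewrite /cos2pi mul0r cos0. Qed.

Lemma cos2pi_quarter t : cos2pi (t - 4^-1) = sin (t * (pi *+ 2)).
Proof.
rewrite /cos2pi mulrBl (_ : 4^-1 * (pi *+ 2) = pi / 2); first exact: cosBpihalf.
by rewrite -mulr_natl; field.
Qed.

Lemma cos2piM s t : cos2pi s * cos2pi t = (cos2pi (s + t) + cos2pi (s - t)) / 2.
Proof. by rewrite /cos2pi (mulrDl s) mulrBl cosD cosB; field. Qed.

(** The real form of the product of a character with the conjugate of another;
    the shift by a quarter turn stands for the sine. *)
Lemma cos2pi_diff s t :
  cos2pi (s - t) = cos2pi s * cos2pi t + cos2pi (s - 4^-1) * cos2pi (t - 4^-1).
Proof. by rewrite !cos2pi_quarter /cos2pi mulrBl cosB. Qed.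

Lemma cos2pi_neq1 t : t \isn't a Num.int -> cos2pi t != 1.
Proof.
move=> tZ; apply/eqP => c1.
pose f := t - (Num.floor t)%:~R.
have fge0 : 0 <= f by rewrite subr_ge0 floor_le_tmp.
have flt1 : f < 1 by rewrite ltrBlDl -intrD1 floorD1_gt.
have fN0 : f != 0.
  by apply: contra tZ => /eqP/subr0_eq->; rewrite intr_int.
have cf : cos2pi f = 1.
  by rewrite /f cos2piDint// rpredN intr_int.
have sp : 0 < sin (f * pi).
  by apply: sin_gt0_pi; rewrite mulr_gt0 ?pi_gt0 ?lt0r ?fN0//= gtr_pMl ?pi_gt0.
move: cf; rewrite /cos2pi mulrnAr cos_mulr2n cos2sin2 => cf.
have : sin (f * pi) ^+ 2 = 0 by lra.
by apply/eqP; rewrite expf_eq0/= gt_eqF.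
Qed.

(** A trigonometric polynomial of degree one in [t] which, on a period, is
    positive exactly on the arc from [a] to [b]: see the factored form
    [arc_funE]. *)
Definition arc_fun a b t :=
  cos2pi (t - (a + b) / 2) / 2 - cos2pi ((b - a) / 2) / 2.

Lemma arc_funE a b t : arc_fun a b t = sin ((t - a) * pi) * sin ((b - t) * pi).
Proof.
have E x y : sin x * sin y = (cos (x - y) - cos (x + y)) / 2.
  by rewrite cosB cosD; field.
rewrite E /arc_fun /cos2pi -mulrBl; congr ((cos _ - cos _) / _);
  by rewrite -mulr_natr; field.
Qed.

Lemma arc_fun_gt0 a b t : 0 <= a -> a <= b -> b <= 1 -> 0 <= t < 1 ->
  (0 < arc_fun a b t) = (a < t < b).
Proof.
move=> a0 ab b1 /andP[t0 t1]; rewrite arc_funE.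
have pi0 := pi_gt0 R.
have [ta|ta] := leP t a => /=.
  apply/negbTE; rewrite -leNgt; apply: mulr_le0_ge0.
    rewrite -[X in X * _]opprB mulNr sinN oppr_le0 sin_ge0_pi//.
    by rewrite mulr_ge0 ?subr_ge0 ?pi_ge0//= ler_piMl ?pi_ge0//; lra.
  by rewrite sin_ge0_pi// mulr_ge0 ?pi_ge0//= ?ler_piMl ?pi_ge0//; lra.
have sa : 0 < sin ((t - a) * pi).
  by rewrite sin_gt0_pi// mulr_gt0 ?subr_gt0//= gtr_pMl//; lra.
rewrite pmulr_rgt0//; have [tb|tb] := ltP t b.
  by rewrite sin_gt0_pi// mulr_gt0 ?subr_gt0//= gtr_pMl//; lra.
apply/negbTE; rewrite -leNgt -[X in X * _]opprB mulNr sinN oppr_le0 sin_ge0_pi//.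
by rewrite mulr_ge0 ?subr_ge0 ?pi_ge0//= ler_piMl ?pi_ge0//; lra.
Qed.

Lemma arc_fun_norm a b t : `|arc_fun a b t| <= 1.
Proof. by rewrite arc_funE normrM mulr_ile1 ?sin_max. Qed.

End CircleCosine.

Section SkewProduct.
Context {R : realType} {Y : Type}.
Variables (X W : Y -> R).

Definition chr (j l : int) (th : R) (y : Y) : R :=
  cos2pi (j%:~R * X y + l%:~R * W y + th).

(** Thanks to the general phase in [chr], these functions are closed under
    products and under composition with a skew product; a sine is a cosine
    whose phase is shifted by a quarter turn. *)
Inductive trigpoly : (Y -> R) -> Prop :=
| trigpoly_chr c j l th : trigpoly (fun y => c * chr j l th y)
| trigpolyD f g : trigpoly f -> trigpoly g -> trigpoly (fun y => f y + g y).

Lemma trigpoly_chr1 j l th : trigpoly (chr j l th).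
Proof.
rewrite (_ : chr j l th = fun y => 1 * chr j l th y); first exact: trigpoly_chr.
by apply/funext => y; rewrite mul1r.
Qed.

Lemma trigpoly_cst c : trigpoly (fun=> c).
Proof.
rewrite (_ : (fun=> c) = fun y => c * chr 0 0 0 y); first exact: trigpoly_chr.
by apply/funext => y; rewrite /chr !mul0r !addr0 cos2pi0 mulr1.
Qed.

Lemma trigpolyZ c f : trigpoly f -> trigpoly (fun y => c * f y).
Proof.
elim=> [c' j l th|{}f g _ tf _ tg].
  by under eq_fun do rewrite mulrA; exact: trigpoly_chr.
by under eq_fun do rewrite mulrDr; exact: trigpolyD.
Qed.

Lemma trigpolyB f g : trigpoly f -> trigpoly g -> trigpoly (fun y => f y - g y).
Proof.
move=> tf tg; apply: trigpolyD => //.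
by under eq_fun do rewrite -mulN1r; exact: trigpolyZ.
Qed.

Lemma trigpolyM f g : trigpoly f -> trigpoly g -> trigpoly (fun y => f y * g y).
Proof.
move=> tf tg; elim: tf => [c j l th|{}f f' _ tf _ tf']; last first.
  by under eq_fun do rewrite mulrDl; exact: trigpolyD.
elim: tg => [c' j' l' th'|{}g g' _ tg _ tg']; last first.
  by under eq_fun do rewrite mulrDr; exact: trigpolyD.
rewrite (_ : (fun y => _) = fun y =>
  (c * c' / 2) * chr (j + j') (l + l') (th + th') y +
  (c * c' / 2) * chr (j - j') (l - l') (th - th') y).
  by apply: trigpolyD; exact: trigpoly_chr.
apply/funext => y; rewrite mulrACA -mulrDr /chr cos2piM mulrA mulrAC; congr (_ * _).
by congr (cos2pi _ + cos2pi _); rewrite ?intrD ?mulrNz; ring.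
Qed.

Lemma trigpolyX f n : trigpoly f -> trigpoly (fun y => f y ^+ n).
Proof.
move=> tf; elim: n => [|n IH]; first by under eq_fun do rewrite expr0; exact: trigpoly_cst.
by under eq_fun do rewrite exprS; exact: trigpolyM.
Qed.

Lemma trigpoly_sum (n : nat) (f : nat -> Y -> R) :
  (forall i, trigpoly (f i)) -> trigpoly (fun y => \sum_(i < n) f i y).
Proof.
move=> tf; elim: n => [|n IH].
  by under eq_fun do rewrite big_ord0; exact: trigpoly_cst.
by under eq_fun do rewrite big_ord_recr; exact: trigpolyD.
Qed.

Lemma trigpoly_arc1 a b : trigpoly (fun y => arc_fun a b (X y)).
Proof.
apply: trigpolyB; last exact: trigpoly_cst.
under eq_fun do rewrite mulrC; apply: trigpolyZ.
rewrite (_ : (fun y => _) = chr 1 0 (- ((a + b) / 2))); first exact: trigpoly_chr1.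
by apply/funext => y; rewrite /chr mul1r mul0r addr0.
Qed.

Lemma trigpoly_arc2 a b : trigpoly (fun y => arc_fun a b (W y)).
Proof.
apply: trigpolyB; last exact: trigpoly_cst.
under eq_fun do rewrite mulrC; apply: trigpolyZ.
rewrite (_ : (fun y => _) = chr 0 1 (- ((a + b) / 2))); first exact: trigpoly_chr1.
by apply/funext => y; rewrite /chr mul1r mul0r add0r.
Qed.

Lemma trigpoly_bounded f : trigpoly f -> exists2 M : R, 0 <= M & forall y, `|f y| <= M.
Proof.
elim=> [c j l th|{}f g _ [M M0 fM] _ [M' M'0 gM]].
  exists `|c|; first exact: normr_ge0.
  by move=> y; rewrite normrM ler_piMr// /chr cos_max.
exists (M + M'); first exact: addr_ge0.
by move=> y; rewrite (le_trans (ler_normD _ _))// lerD.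
Qed.

Variables (T : Y -> Y) (al del : R).
Hypothesis XT : forall y, X (T y) - (X y + al) \is a Num.int.
Hypothesis WT : forall y, W (T y) - (W y - X y + del) \is a Num.int.

(** The skew product turns the frequency [(j, l)] into [(j - l, l)]: a
    character with [l != 0] never comes back to a multiple of itself. *)
Lemma chr_shift j l th y :
  chr j l th (T y) = chr (j - l) l (th + (j%:~R * al + l%:~R * del)) y.
Proof.
rewrite /chr.
have -> : j%:~R * X (T y) + l%:~R * W (T y) + th =
  ((j - l)%:~R * X y + l%:~R * W y + (th + (j%:~R * al + l%:~R * del))) +
  (j%:~R * (X (T y) - (X y + al)) + l%:~R * (W (T y) - (W y - X y + del))).
  by rewrite intrB; ring.
by rewrite cos2piDint// rpredD// rpredM ?intr_int.
Qed.

Lemma trigpoly_comp f : trigpoly f -> trigpoly (f \o T).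
Proof.
elim=> [c j l th|{}f g _ tf _ tg]; last exact: (trigpolyD tf tg).
rewrite (_ : _ \o _ = fun y => c * chr (j - l) l (th + (j%:~R * al + l%:~R * del)) y).
  exact: trigpoly_chr.
by apply/funext => y /=; rewrite chr_shift.
Qed.

(** The phase [p] does not depend on [th], so that a cosine and the sine of the
    same angle are moved together. *)
Lemma chr_iter j l h : exists p : R, forall th y,
  chr j l th (iter h T y) = chr (j - l * h%:Z) l (th + p) y.
Proof.
elim: h => [|h [p IH]].
  by exists 0 => th y; rewrite mulr0 subr0 addr0.
exists (p + ((j - l * h%:Z)%:~R * al + l%:~R * del)) => th y.
rewrite iterSr IH chr_shift addrA; congr (chr _ _ _ _).
  by rewrite intS mulrDr mulr1 opprD addrA addrAC.
by rewrite !addrA.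
Qed.

(** Integration against an invariant probability and limits of orbit averages
    have these properties on the trigonometric polynomials, which are continuous
    and bounded. *)
Record mean (L : (Y -> R) -> R) : Prop := Mean {
  meanD : forall f g, trigpoly f -> trigpoly g ->
    L (fun y => f y + g y) = L f + L g;
  meanZ : forall c f, trigpoly f -> L (fun y => c * f y) = c * L f;
  mean_ge0 : forall f, trigpoly f -> (forall y, 0 <= f y) -> 0 <= L f;
  mean1 : L (fun=> 1) = 1;
  mean_inv : forall f, trigpoly f -> L (f \o T) = L f }.

Section Mean.
Variable L : (Y -> R) -> R.
Hypothesis mL : mean L.

Lemma mean_cst c : L (fun=> c) = c.
Proof.
have := meanZ mL c (trigpoly_cst 1); rewrite (mean1 mL) mulr1 => {2}<-.
by congr L; apply/funext => y /=; rewrite mulr1.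
Qed.

Lemma meanB f g : trigpoly f -> trigpoly g ->
  L (fun y => f y - g y) = L f - L g.
Proof.
move=> tf tg.
rewrite (_ : (fun y => _) = fun y => f y + (- 1) * g y); last first.
  by apply/funext => y; rewrite mulN1r.
by rewrite (meanD mL)// ?(meanZ mL) ?mulN1r//; exact: trigpolyZ.
Qed.

Lemma mean_sum n (f : nat -> Y -> R) : (forall i, trigpoly (f i)) ->
  L (fun y => \sum_(i < n) f i y) = \sum_(i < n) L (f i).
Proof.
move=> tf; elim: n => [|n IH].
  by under eq_fun do rewrite big_ord0; rewrite big_ord0 mean_cst.
under eq_fun do rewrite big_ord_recr.
by rewrite (meanD mL) ?IH ?big_ord_recr//; exact: trigpoly_sum.
Qed.

Lemma mean_le f g : trigpoly f -> trigpoly g -> (forall y, f y <= g y) ->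
  L f <= L g.
Proof.
move=> tf tg fg; rewrite -subr_ge0 -meanB// (mean_ge0 mL)//; first exact: trigpolyB.
by move=> y; rewrite subr_ge0.
Qed.

(** Cauchy-Schwarz against the constant 1, from the positivity of the variance. *)
Lemma mean_sqr f : trigpoly f -> L f ^+ 2 <= L (fun y => f y ^+ 2).
Proof.
move=> tf.
have : 0 <= L (fun y => (f y - L f) ^+ 2).
  apply: (mean_ge0 mL); last by move=> y; exact: sqr_ge0.
  by apply/trigpolyX/trigpolyB => //; exact: trigpoly_cst.
under eq_fun do rewrite sqrrB.
rewrite (meanD mL); last exact: trigpoly_cst; last first.
  apply: trigpolyB; first exact: trigpolyX.
  under eq_fun do rewrite -mulr_natl; apply: trigpolyZ.
  by under eq_fun do rewrite mulrC; exact: trigpolyZ.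
rewrite meanB; last 2 first.
- exact: trigpolyX.
- under eq_fun do rewrite -mulr_natl; apply: trigpolyZ.
  by under eq_fun do rewrite mulrC; exact: trigpolyZ.
rewrite (_ : (fun y => f y * L f *+ 2) = fun y => (L f *+ 2) * f y); last first.
  by apply/funext => y; rewrite mulrnAl mulrC.
by rewrite (meanZ mL)// mean_cst => h; nra.
Qed.

Lemma mean_iter f h : trigpoly f -> L (fun y => f (iter h T y)) = L f.
Proof.
move=> tf; elim: h => // h IH.
suff th : trigpoly (fun y => f (iter h T y)).
  rewrite -[RHS]IH -[RHS](mean_inv mL)//.
  by congr L; apply/funext => y /=; rewrite -iterSr.
by elim: h {IH} => // h IH; have := trigpoly_comp IH; congr trigpoly;
  apply/funext => y /=; rewrite -iterSr.
Qed.

Hypothesis irr : forall j : int, j != 0 -> j%:~R * al \isn't a Num.int.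

(** Adding the translates of a character by the angles [j * al] and
    [- j * al] multiplies it by twice the cosine of that angle, whereas
    invariance says that its mean is multiplied by 2. *)
Lemma mean_chr_base j th : j != 0 -> L (chr j 0 th) = 0.
Proof.
move=> j0; set b := j%:~R * al.
have inv t : L (chr j 0 (t + b)) = L (chr j 0 t).
  rewrite -[RHS](mean_inv mL); last exact: trigpoly_chr1.
  congr L; apply/funext => y /=; rewrite chr_shift.
  by congr (chr _ _ _ _); rewrite ?subr0 ?mulr0z ?mul0r ?addr0.
have : L (chr j 0 (th + b)) + L (chr j 0 (th - b)) = 2 * cos2pi b * L (chr j 0 th).
  rewrite -(meanD mL); do ?exact: trigpoly_chr1.
  rewrite -(meanZ mL); last exact: trigpoly_chr1.
  congr L; apply/funext => y.
  rewrite /chr !addrA; set x := _ + th.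
  by rewrite (mulrC 2) mulrAC (mulrC (cos2pi b)) cos2piM; field.
rewrite inv -[X in _ + X = _]inv subrK => h.
have : (1 - cos2pi b) * L (chr j 0 th) = 0 by lra.
by move/eqP; rewrite mulf_eq0 subr_eq0 eq_sym (negbTE (cos2pi_neq1 (irr j0)))/= => /eqP.
Qed.

(** With [u] and [v] the cosine and the sine of the angle along the orbit, the
    products [u h * u k + v h * v k] are characters in [X] alone: they have
    mean 0 for [h != k], so the sum of [H] translates has a squared modulus of
    mean [H] instead of [H ^ 2]. *)
Lemma mean_chr_le j l th H : l != 0 ->
  H.+1%:R * L (chr j l th) ^+ 2 <= 1.
Proof.
move=> l0.
pose u h y := chr j l th (iter h T y).
pose v h y := chr j l (th - 4^-1) (iter h T y).
have [p chrE] : exists p : nat -> R, forall h t y,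
    chr j l t (iter h T y) = chr (j - l * h%:Z) l (t + p h) y.
  by have [p pE] := choice (chr_iter j l); exists p => h t y; exact: pE.
have tu h : trigpoly (u h).
  by rewrite /u; under eq_fun do rewrite chrE; exact: trigpoly_chr1.
have tv h : trigpoly (v h).
  by rewrite /v; under eq_fun do rewrite chrE; exact: trigpoly_chr1.
pose S (w : nat -> Y -> R) y := \sum_(h < H.+1) w h y.
have Lu : L (S u) = H.+1%:R * L (chr j l th).
  rewrite mean_sum// (eq_bigr (fun=> L (chr j l th))); last first.
    by move=> h _; rewrite mean_iter//; exact: trigpoly_chr1.
  by rewrite big_const_ord iter_addr_0 mulr_natl.
have tuv h k : trigpoly (fun y => u h y * u k y + v h y * v k y).
  by apply: trigpolyD; exact: trigpolyM.
have corr h k : L (fun y => u h y * u k y + v h y * v k y) = (h == k)%:R.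
  rewrite (_ : (fun y => _) = chr (l * (k%:Z - h%:Z)) 0 (p h - p k)); last first.
    apply/funext => y; rewrite /u /v !chrE /chr.
    rewrite (addrAC th) (addrAC th _ (p k)) !addrA -cos2pi_diff; congr cos2pi.
    by rewrite !(intrD, intrM, mulrNz); ring.
  have [->|hk] := eqVneq h k.
    rewrite (_ : chr _ _ _ = fun=> 1) ?(mean1 mL)//; apply/funext => y.
    by rewrite /chr !subrr mulr0 !mul0r !addr0 cos2pi0.
  by rewrite mean_chr_base// mulf_neq0// subr_eq0 eqz_nat eq_sym.
have sq : L (fun y => S u y ^+ 2 + S v y ^+ 2) = H.+1%:R.
  rewrite (_ : (fun y => _) = fun y => \sum_(h < H.+1) \sum_(k < H.+1)
      (u h y * u k y + v h y * v k y)); last first.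
    apply/funext => y; rewrite !expr2 /S !big_distrlr -big_split/=.
    by apply: eq_bigr => h _; rewrite big_split.
  pose g h y := \sum_(k < H.+1) (u h y * u k y + v h y * v k y).
  rewrite (@mean_sum _ g); last first.
    move=> h.
    exact: (@trigpoly_sum H.+1 (fun k y => u h y * u k y + v h y * v k y)).
  rewrite (eq_bigr (fun=> 1)) ?sumr_const ?card_ord// => h _.
  rewrite (@mean_sum _ (fun k y => u h y * u k y + v h y * v k y))//.
  rewrite (bigD1 h)//= corr eqxx big1 ?addr0// => k kh.
  by rewrite corr (_ : (_ == _) = false)//; apply: contraNF kh => /eqP/val_inj->.
have : L (S u) ^+ 2 <= H.+1%:R.
  rewrite -sq (le_trans (mean_sqr _))//; first exact: trigpoly_sum.
  apply: mean_le.
  - by apply: trigpolyX; exact: trigpoly_sum.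
  - by apply: trigpolyD; apply: trigpolyX; exact: trigpoly_sum.
  - by move=> y; rewrite lerDl sqr_ge0.
by rewrite Lu exprMn expr2 -mulrA ger_pMr// ltr0n.
Qed.

Lemma mean_chr j l th : (j != 0) || (l != 0) -> L (chr j l th) = 0.
Proof.
have [->|l0 _] := eqVneq l 0; first by rewrite orbF; exact: mean_chr_base.
apply/eqP/negP => /negP L0.
have s0 : 0 < L (chr j l th) ^+ 2 by rewrite exprn_even_gt0.
pose H := Num.truncn (L (chr j l th) ^- 2).
have := mean_chr_le j th H l0.
rewrite -ler_pdivlMr// mul1r leNgt; case/negP.
by rewrite truncnS_gt.
Qed.

End Mean.

Lemma mean_unique L L' : (forall j : int, j != 0 -> j%:~R * al \isn't a Num.int) ->
  mean L -> mean L' -> forall f, trigpoly f -> L f = L' f.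
Proof.
move=> irr mL mL' f; elim=> [c j l th|{}f g tf IHf tg IHg]; last first.
  by rewrite (meanD mL)// (meanD mL')// IHf IHg.
rewrite (meanZ mL) ?(meanZ mL'); do ?exact: trigpoly_chr1.
have [/orP jl|] := boolP ((j != 0) || (l != 0)).
  by rewrite !mean_chr//; apply/orP.
rewrite negb_or !negbK => /andP[/eqP-> /eqP->].
rewrite (_ : chr 0 0 th = fun=> cos2pi th) ?mean_cst//.
by apply/funext => y; rewrite /chr !mul0r !add0r.
Qed.

End SkewProduct.

(** * Polynomial step functions and Borel measurability *)
Section StepFunctions.
Context {R : realType}.
Implicit Types t x : R.

Lemma bernoulli_ge x n : -1 <= x -> 1 + n%:R * x <= (1 + x) ^+ n.
Proof.
move=> x1; elim: n => [|n IH]; first by rewrite mul0r addr0.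
rewrite exprS (le_trans _ (ler_wpM2l _ IH))//; last by rewrite -lerBlDl sub0r.
have : 0 <= n%:R * x ^+ 2 by rewrite mulr_ge0// sqr_ge0.
by rewrite -natr1 => ?; lra.
Qed.

(** A polynomial in [t], close to 1 below 1/2 and close to 0 from 1/2 on.  The
    factor [n] in the exponent decides the value at 1/2: without it the limit
    there would be [1 / e] instead of 0. *)
Definition step n t := (1 - t ^+ n) ^+ (n * 2 ^ n).

Lemma step_itv n t : 0 <= t <= 1 -> 0 <= step n t <= 1.
Proof.
move=> /andP[t0 t1]; have tn0 : 0 <= t ^+ n by rewrite exprn_ge0.
have tn1 : t ^+ n <= 1 by rewrite exprn_ile1.
by rewrite /step exprn_ge0 ?subr_ge0//= exprn_ile1 ?subr_ge0// gerBl.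
Qed.

Lemma step_le n t : 2^-1 <= t <= 1 -> step n t <= n.+1%:R^-1.
Proof.
move=> /andP[t2 t1]; have t0 : 0 <= t by apply: le_trans t2.
have tn0 : 0 <= t ^+ n by rewrite exprn_ge0.
have tn1 : t ^+ n <= 1 by rewrite exprn_ile1.
have : step n t * n.+1%:R <= 1.
  apply: (@le_trans _ _ (step n t * (1 + t ^+ n) ^+ (n * 2 ^ n))).
    apply: ler_wpM2l; first by have /andP[] := @step_itv n t (introT andP (conj t0 t1)).
    apply: le_trans (bernoulli_ge _ _); last by rewrite (le_trans _ tn0)// lerN10.
    rewrite -natr1 addrC lerD2l natrM -mulrA ler_peMr// natrX -exprMn.
      by apply: exprn_ege1; lra.
  rewrite /step -exprMn -subr_sqr expr1n exprn_ile1 ?subr_ge0 ?exprn_ile1//.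
  by rewrite gerBl sqr_ge0.
by rewrite -ler_pdivlMr// mul1r.
Qed.

(** With [r] the square root of [x], the sequence [n * r ^ n] is bounded by the
    geometric series, and the other factor [r ^ n] tends to 0. *)
Lemma cvg_natmul_expr x : 0 <= x < 1 -> n%:R * x ^+ n @[n --> \oo] --> (0 : R).
Proof.
move=> /andP[x0 x1].
pose r := Num.sqrt x.
have r0 : 0 <= r by exact: sqrtr_ge0.
have r1 : r < 1 by rewrite -sqrtr1 ltr_sqrt.
have xr : x = r * r by rewrite -expr2 sqr_sqrtr.
have nr n : n%:R * r ^+ n <= (1 - r)^-1.
  rewrite -[leRHS]mul1r ler_pdivlMr ?subr_gt0//.
  have : (1 - r) * (\sum_(i < n) r ^+ i) = 1 - r ^+ n.
    have := subrXX 1 r n; rewrite expr1n => ->; congr (_ * _).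
    by apply: eq_bigr => i _; rewrite expr1n mul1r.
  have : n%:R * r ^+ n <= \sum_(i < n) r ^+ i.
    rewrite -[X in X%:R]card_ord -sumr_const mulr_suml ler_sum// => i _.
    by rewrite mul1r ler_wiXn2l ?(ltW r1)// ltnW.
  have : 0 <= r ^+ n by rewrite exprn_ge0.
  by move: (\sum_(_ < _) _) => s; nra.
apply: (@squeeze_cvgr _ _ _ _ (cst 0) (fun n => (1 - r)^-1 * r ^+ n)).
- apply: nearW => n; rewrite mulr_ge0 ?exprn_ge0//= xr exprMn mulrA.
  by rewrite ler_wpM2r ?exprn_ge0.
- exact: cvg_cst.
- rewrite -[X in _ --> X](mulr0 (1 - r)^-1).
  by apply: cvgMr; apply: cvg_expr; rewrite ger0_norm.
Qed.

Lemma cvg_step t : 0 <= t <= 1 -> step n t @[n --> \oo] --> ((t < 2^-1)%R%:R : R).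
Proof.
move=> t01; have /andP[t0 t1] := t01; have [t2|t2] := ltP t 2^-1.
  have tt : 0 <= t * 2 < 1 by rewrite mulr_ge0//= -ltr_pdivlMr// div1r.
  apply: (@squeeze_cvgr _ _ _ _ (fun n => 1 - n%:R * (t * 2) ^+ n) (cst 1)).
  - apply: nearW => n; have /andP[_ ->] := step_itv n t01; rewrite andbT.
    have := @bernoulli_ge (- t ^+ n) (n * 2 ^ n).
    rewrite lerN2 exprn_ile1// => /(_ isT); apply: le_trans.
    by rewrite natrM exprMn mulrN mulrAC mulrA natrX.
  - rewrite -[X in _ --> X]subr0; apply: cvgB; first exact: cvg_cst.
    exact: cvg_natmul_expr.
  - exact: cvg_cst.
apply: (@squeeze_cvgr _ _ _ _ (cst 0) (@harmonic R)).
- apply: nearW => n; have /andP[-> _] := step_itv n t01.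
  by apply: step_le; rewrite t2.
- exact: cvg_cst.
- exact: cvg_harmonic.
Qed.

End StepFunctions.

Lemma trigpoly_step (R : realType) Y (X W : Y -> R) f n :
  trigpoly X W f -> trigpoly X W (fun y => step n (f y)).
Proof.
move=> tf; apply: trigpolyX; apply: trigpolyB; first exact: trigpoly_cst.
exact: trigpolyX.
Qed.

Section BorelMeasurability.
Context {R : realType}.

Lemma continuous_borel_fun (Y : ptopologicalType) (f : Y -> R) :
  continuous f -> measurable_fun setT (f : borel Y -> R).
Proof.
move=> /continuousP cf _; apply: (measurability _ (RGenOpens.measurableE R)) => //.
move=> _ [_ [a [b ->] <-]]; rewrite setTI; apply: sub_sigma_algebra; exact/cf/interval_open.
Qed.

Lemma open_measurable_prod (O : set (R * R)) : open O -> measurable O.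
Proof.
move=> oO.
pose box (q : (rat * rat) * (rat * rat)) : set (R * R) :=
  `]ratr q.1.1, ratr q.1.2[%classic `*` `]ratr q.2.1, ratr q.2.2[%classic.
rewrite [X in measurable X](_ : _ = \bigcup_(q in [set q | box q `<=` O]) box q).
  rewrite bigcup_mkcond; apply: countable_bigcupT_measurable => // q.
  by case: ifPn => // _; apply: measurableX; exact: measurable_itv.
apply/seteqP; split => [[x y] Oxy|p [q /= qO]]; last exact: qO.
have /nbhs_ballP[e/= e0 eO] : nbhs (x, y) O by exact: open_nbhs_nbhs.
have lo z : z - e < z by rewrite ltrBlDr ltrDl.
have hi z : z < z + e by rewrite ltrDl.
have [[a +] [b +]] := (rat_in_itvoo (lo x), rat_in_itvoo (hi x)).
have [[c +] [d +]] := (rat_in_itvoo (lo y), rat_in_itvoo (hi y)).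
rewrite !in_itv/= => /andP[c1 c2] /andP[d1 d2] /andP[a1 a2] /andP[b1 b2].
exists ((a, b), (c, d)); last by rewrite /box/= !in_itv/= a2 b1 c2 d1.
move=> [x' y'] [/=]; rewrite !in_itv/= => /andP[ax xb] /andP[cy yd].
apply: eO; split; rewrite /= /ball/= ltr_norml; apply/andP; split; lra.
Qed.

Lemma continuous_borel_prod (Z : ptopologicalType) (f : R * R -> Z) :
  continuous f -> measurable_fun setT (f : R * R -> borel Z).
Proof.
move=> /continuousP cf; apply: measurability => // _ [B oB <-].
by rewrite setTI; apply: open_measurable_prod; exact: cf.
Qed.

End BorelMeasurability.

(** * Measures on a space charted by the two-dimensional torus *)
(** [F] is the covering map from the plane, and [X], [W] are the coordinates
    with values in the fundamental square.  They are not continuous, but their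
    characters are. *)
Record torus_chart (R : realType) (Y : ptopologicalType)
    (X W : Y -> R) (F : R * R -> Y) : Prop := TorusChart {
  chart_X : forall y, 0 <= X y < 1;
  chart_W : forall y, 0 <= W y < 1;
  chart_K : forall y, F (X y, W y) = y;
  chart_XF : forall p, X (F p) - p.1 \is a Num.int;
  chart_WF : forall p, W (F p) - p.2 \is a Num.int;
  chart_periodic : forall (p : R * R) (u v : R),
    u \is a Num.int -> v \is a Num.int -> F (p.1 + u, p.2 + v) = F p;
  chart_cont : continuous F;
  chart_chr : forall j l th, continuous (chr X W j l th) }.

Section TorusChart.
Context {R : realType} {Y : ptopologicalType}.
Variables (X W : Y -> R) (F : R * R -> Y).
Hypothesis chart : torus_chart X W F.
Local Notation trig := (trigpoly X W).

Lemma trigpoly_measurable f : trig f -> measurable_fun setT (f : borel Y -> R).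
Proof.
move=> tf; apply: continuous_borel_fun.
elim: tf => [c j l th|{}f g _ cf _ cg] y.
  by apply: cvgMr; exact: (chart_chr chart).
by apply: cvgD; [exact: cf|exact: cg].
Qed.

Lemma trigpoly_integrable (m : probability (borel Y) R) f : trig f ->
  m.-integrable setT (EFin \o f).
Proof.
move=> tf; apply: measurable_bounded_integrable => //.
- by rewrite (le_lt_trans (probability_le1 _ _)) ?ltry.
- exact: trigpoly_measurable.
- have [M M0 fM] := trigpoly_bounded tf.
  by exists M; split; [exact: num_real|move=> x Mx y _; exact: le_trans (fM _) (ltW Mx)].
Qed.

Lemma mean_Rintegral T (m : probability (borel Y) R) al del :
  (forall y, X (T y) - (X y + al) \is a Num.int) ->
  (forall y, W (T y) - (W y - X y + del) \is a Num.int) ->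
  measure_preserving m T -> mean X W T (fun f => (\int[m]_y f y)%R).
Proof.
move=> XT WT [mT mpT]; split => [f g tf tg|c f tf|f tf f0||f tf].
- by rewrite RintegralD//; exact: trigpoly_integrable.
- by rewrite RintegralZl//; exact: trigpoly_integrable.
- by apply: Rintegral_ge0 => y _; exact: f0.
- rewrite Rintegral_cst// mul1r [X in fine X](_ : _ = 1%E)//; exact: probability_setT.
- have tfT : trig (f \o T) by exact: trigpoly_comp XT WT _ tf.
  congr fine.
  have := @integral_pushforward _ _ _ _ _ _ mT m setT (EFin \o f).
  rewrite preimage_setT => <-//.
  + by apply: eq_measure_integral => A mA _; exact: mpT.
  + by apply/measurable_EFinP; exact: (trigpoly_measurable tf).
  + exact: (trigpoly_integrable m tfT).
Qed.

(** The sets that are bounded pointwise limits of trigonometric polynomials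
    form a pi-system rich enough to generate the Borel sets. *)
Definition trig_set (E : set Y) := exists f : nat -> Y -> R,
  [/\ forall n, trig (f n), forall n y, 0 <= f n y <= 1 &
      forall y, f n y @[n --> \oo] --> (\1_E y : R)].

Lemma trig_setI : setI_closed trig_set.
Proof.
move=> E E' [f [tf f01 fE]] [g [tg g01 gE]].
exists (fun n y => f n y * g n y); split => [n|n y|y].
- exact: trigpolyM.
- have /andP[f0 f1] := f01 n y; have /andP[g0 g1] := g01 n y.
  by rewrite mulr_ge0//= mulr_ile1.
- by rewrite indicI; apply: cvgM; [exact: fE|exact: gE].
Qed.

Lemma trig_set0 : trig_set set0.
Proof.
exists (fun _ _ => 0); split => [n|n y|y]; first exact: trigpoly_cst.
  by rewrite lexx ler01.
by rewrite indic0; exact: cvg_cst.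
Qed.

Lemma trig_setT : trig_set setT.
Proof.
exists (fun _ _ => 1); split => [n|n y|y]; first exact: trigpoly_cst.
  by rewrite lexx ler01.
by rewrite indicT; exact: cvg_cst.
Qed.

(** The affine change of variable puts the zeros of [arc_fun] at the threshold
    1/2 of [step], and its values in the unit interval. *)
Definition arc_step n a b (t : R) := step n ((1 - arc_fun a b t) / 2).

Lemma half_arc_itv a b (t : R) : 0 <= (1 - arc_fun a b t) / 2 <= 1.
Proof.
have := arc_fun_norm a b t; rewrite ler_norml => /andP[? ?].
by apply/andP; split; lra.
Qed.

Lemma arc_step_itv n a b t : 0 <= arc_step n a b t <= 1.
Proof. exact/step_itv/half_arc_itv. Qed.

Lemma arc_step_le n a b t : 0 <= a -> a <= b -> b <= 1 -> 0 <= t < 1 ->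
  ~~ (a < t < b) -> arc_step n a b t <= n.+1%:R^-1.
Proof.
move=> a0 ab b1 t01; rewrite -arc_fun_gt0// -leNgt => h.
by apply: step_le; have /andP[_ ->] := half_arc_itv a b t; rewrite andbT; lra.
Qed.

Lemma cvg_arc_step a b t : 0 <= a -> a <= b -> b <= 1 -> 0 <= t < 1 ->
  arc_step n a b t @[n --> \oo] --> ((a < t < b)%R%:R : R).
Proof.
move=> a0 ab b1 t01; rewrite -arc_fun_gt0//.
rewrite (_ : (0 < _) = ((1 - arc_fun a b t) / 2 < 2^-1)); last first.
  by apply/idP/idP => ?; lra.
by apply: cvg_step; exact: half_arc_itv.
Qed.

Lemma trigpoly_arc_step1 n a b : trig (fun y => arc_step n a b (X y)).
Proof.
apply: trigpoly_step; under eq_fun do rewrite mulrC.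
by apply/trigpolyZ/trigpolyB; [exact: trigpoly_cst|exact: trigpoly_arc1].
Qed.

Lemma trigpoly_arc_step2 n a b : trig (fun y => arc_step n a b (W y)).
Proof.
apply: trigpoly_step; under eq_fun do rewrite mulrC.
by apply/trigpolyZ/trigpolyB; [exact: trigpoly_cst|exact: trigpoly_arc2].
Qed.

Lemma trig_set_arc (Z : Y -> R) a b : (forall y, 0 <= Z y < 1) ->
  (forall n, trig (fun y => arc_step n a b (Z y))) ->
  0 <= a -> a <= b -> b <= 1 -> trig_set [set y | a < Z y < b].
Proof.
move=> Z01 tZ a0 ab b1; exists (fun n y => arc_step n a b (Z y)); split => //.
  by move=> n y; exact: arc_step_itv.
move=> y; rewrite indicE (_ : (y \in _) = (a < Z y < b)); first exact: cvg_arc_step.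
by apply/idP/idP => [/set_mem|/mem_set].
Qed.

Lemma trig_set_ray (Z : Y -> R) (a : R) : (forall y, 0 <= Z y < 1) ->
  (forall n a b, trig (fun y => arc_step n a b (Z y))) ->
  trig_set [set y | a < Z y].
Proof.
move=> Z01 tZ; have [a0|a0] := ltP a 0.
  rewrite (_ : [set _ | _] = setT); first exact: trig_setT.
  by apply/seteqP; split => // y _ /=; have /andP[? _] := Z01 y; lra.
have [a1|a1] := leP 1 a.
  rewrite (_ : [set _ | _] = set0); first exact: trig_set0.
  by apply/seteqP; split => // y /=; have /andP[_ ?] := Z01 y; lra.
rewrite (_ : [set _ | _] = [set y | a < Z y < 1]).
  by apply: trig_set_arc => //; exact: ltW.
by apply/seteqP; split => y /=; have /andP[_ ->] := Z01 y; rewrite andbT.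
Qed.

(** Rays [a < X] are arcs ending at 1, hence in the pi-system; this is why the
    coordinates are measurable for the sigma-algebra that it generates. *)
Lemma trig_coord_measurable :
  measurable_fun setT (fun y : g_sigma_algebraType trig_set => (X y, W y)).
Proof.
have mcoord (Z : Y -> R) : (forall y, 0 <= Z y < 1) ->
    (forall n a b, trig (fun y => arc_step n a b (Z y))) ->
    measurable_fun setT (Z : g_sigma_algebraType trig_set -> R).
  move=> Z01 tZ _.
  apply: (measurability _ (RGenOInfty.measurableE R)) => //.
  move=> _ [_ [a ->] <-]; rewrite setTI; apply: sub_sigma_algebra.
  rewrite (_ : _ @^-1` _ = [set y | a < Z y]); first exact: trig_set_ray.
  by apply/seteqP; split => y /=; rewrite in_itv/= andbT.
apply: measurable_fun_pair; apply: mcoord.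
- exact: chart_X chart.
- by move=> n a b; exact: trigpoly_arc_step1.
- exact: chart_W chart.
- by move=> n a b; exact: trigpoly_arc_step2.
Qed.

(** A Borel set is the preimage under [(X, W)] of its preimage under [F]. *)
Lemma trig_set_gen : (@measurable _ (borel Y)) `<=` <<s trig_set >>.
Proof.
move=> B mB.
have mFB : measurable (F @^-1` B).
  rewrite -[X in measurable X]setTI.
  exact: (continuous_borel_prod (chart_cont chart)).
have := trig_coord_measurable measurableT mFB; rewrite setTI; congr (<<s _ >> _).
by apply/seteqP; split => y /=; rewrite (chart_K chart).
Qed.

Lemma trig_set_measurable : trig_set `<=` (@measurable _ (borel Y)).
Proof.
move=> E [f [tf _ fE]]; apply/(measurable_indicP R).
apply: measurable_fun_cvg; last by move=> y _; exact: fE.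
by move=> n; exact: trigpoly_measurable.
Qed.

Lemma chart_coord_measurable : measurable_fun setT (fun y : borel Y => (X y, W y)).
Proof.
move=> _ E mE; rewrite setTI.
have := trig_coord_measurable measurableT mE; rewrite setTI.
apply: smallest_sub trig_set_measurable _.
exact: (@sigma_algebra_measurable _ (borel Y)).
Qed.

Lemma cvg_trig_set (m : probability (borel Y) R) (E : set Y) f :
  (forall n, trig (f n)) -> (forall n y, 0 <= f n y <= 1) ->
  (forall y, f n y @[n --> \oo] --> (\1_E y : R)) ->
  (\int[m]_y f n y)%R @[n --> \oo] --> fine (m E).
Proof.
move=> tf f01 fE.
have mE : measurable (E : set (borel Y)) by apply: trig_set_measurable; exists f.
have : (\int[m]_y (f n y)%:E)%E @[n --> \oo] --> (\int[m]_y (\1_E y)%:E)%E.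
  apply: (@dominated_cvg _ _ _ m setT _ _ _ (cst 1%E)) => //.
  - by move=> n; apply/measurable_EFinP; exact: (trigpoly_measurable (tf n)).
  - by move=> y _; apply: cvg_EFin; [exact: nearW|exact: fE].
  - exact: finite_measure_integrable_cst.
  - move=> n y _ /=; have /andP[f0 f1] := f01 n y.
    by rewrite lee_fin ger0_norm.
rewrite integral_indic// setIT -[X in _ --> X]fineK; last exact: fin_num_measure.
by move=> /fine_cvgP[].
Qed.

Lemma trig_determines (m m' : probability (borel Y) R) :
  (forall f, trig f -> (\int[m]_y f y)%R = (\int[m']_y f y)%R) ->
  forall B : set (borel Y), measurable B -> m B = m' B.
Proof.
move=> mm' B mB.
apply: (@g_sigma_algebra_measure_unique _ R (borel Y) trig_set _ (fun=> setT) _ _ m m').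
- exact: trig_set_measurable.
- by move=> _; exact: trig_setT.
- by rewrite bigcup_const.
- exact: trig_setI.
- move=> E tE; have mE := trig_set_measurable tE.
  case: tE => f [tf f01 fE].
  rewrite -[LHS]fineK -1?[RHS]fineK; do ?exact: fin_num_measure.
  have mf := @cvg_trig_set m _ _ tf f01 fE; have m'f := @cvg_trig_set m' _ _ tf f01 fE.
  congr EFin; apply: (cvg_unique (@Rhausdorff R) mf).
  rewrite (_ : (fun n => _) = (fun n => (\int[m']_y f n y)%R))//.
  by apply/funext => n; exact: mm'.
- by move=> _; rewrite (le_lt_trans (probability_le1 _ _)) ?ltry.
- exact: trig_set_gen.
Qed.

End TorusChart.

(** * Haar measure of the circle and of the torus *)
Section CircleMeasure.
Context {R : realType}.
Implicit Types (x a t : R) (E : set R).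

Definition fract t := t - (Num.floor t)%:~R.

Lemma fract_itv t : 0 <= fract t < 1.
Proof. by rewrite subr_ge0 floor_le_tmp/= ltrBlDl -intrD1 floorD1_gt. Qed.

Lemma fractB_int t : fract t - t \is a Num.int.
Proof. by rewrite addrAC subrr add0r rpredN intr_int. Qed.

Lemma fract_uniq t u : 0 <= u < 1 -> u - t \is a Num.int -> fract t = u.
Proof.
move=> u01 utZ; apply/eqP; rewrite -subr_eq0.
have /intrP[i ui] : fract t - u \is a Num.int.
  rewrite (_ : _ - _ = (fract t - t) - (u - t)); last by ring.
  by rewrite rpredB// fractB_int.
have /andP[f0 f1] := fract_itv t; have /andP[u0 u1] := u01.
rewrite ui intr_eq0; have : `|i%:~R| < 1 :> R.
  by rewrite -ui ltr_norml; apply/andP; split; lra.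
by rewrite -intr_norm -[1]/(1%:~R) ltr_int; case: i {ui} => -[|n].
Qed.

Lemma measurable_fract : measurable_fun setT fract.
Proof.
apply: measurable_funB; first exact: measurable_id.
apply: nondecreasing_measurable => // x y xy.
by rewrite ler_int; exact: le_floor.
Qed.

Lemma lebesgue_shift a E : measurable E ->
  lebesgue_measure ((fun x => x + a) @^-1` E) = lebesgue_measure E.
Proof.
move=> mE.
rewrite -[LHS]/(pushforward lebesgue_measure
  ((fun x => x + a) : measurableTypeR R -> measurableTypeR R) E).
apply/esym/lebesgue_measure_unique => //=; first exact: measurable_funD.
move=> mf _ [[b c] _ <-].
rewrite /pushforward.
rewrite (_ : _ @^-1` _ = `]b - a, c - a]%classic); last first.
  by apply/seteqP; split => x /=; rewrite !in_itv/= ltrBlDr lerBrDr.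
by rewrite !lebesgue_measure_itv/= !lte_fin ltrD2r -!EFinB; case: ifP => // _; congr EFin; ring.
Qed.

Definition circle_measure : set R -> \bar R :=
  mrestr lebesgue_measure (measurable_itv `[0%R, 1%R[).

Let circle_measure0 : circle_measure set0 = 0%E.
Proof. exact: measure0. Qed.

Let circle_measure_ge0 E : (0 <= circle_measure E)%E.
Proof. exact: measure_ge0. Qed.

Let circle_measure_sigma_additive : semi_sigma_additive circle_measure.
Proof.
exact: (@measure_semi_sigma_additive _ (measurableTypeR R) R
  [the {measure set (measurableTypeR R) -> \bar R} of
    mrestr lebesgue_measure (measurable_itv `[0%R, 1%R[)]).
Qed.

HB.instance Definition _ := isMeasure.Build _ R R circle_measure
  circle_measure0 circle_measure_ge0 circle_measure_sigma_additive.

Lemma circle_measure_setT : circle_measure setT = 1%E.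
Proof.
by rewrite /circle_measure /mrestr setTI lebesgue_measure_itv/= lte_fin ltr01 oppr0 adde0.
Qed.

HB.instance Definition _ :=
  Measure_isProbability.Build _ _ _ circle_measure circle_measure_setT.

(** Up to an integer the rotation is by some [b] in the unit interval; it is
    then the exchange of two intervals, each translated. *)
Lemma circle_rotation a E : measurable E ->
  circle_measure ((fun x => fract (x + a)) @^-1` E) = circle_measure E.
Proof.
move=> mE; rewrite /circle_measure /mrestr.
pose b := fract a; have /andP[b0 b1] := fract_itv a; rewrite -/b in b0 b1.
have fE x c : 0 <= x + c < 1 -> (c = b) \/ (c = b - 1) -> fract (x + a) = x + c.
  move=> xc cb; apply: fract_uniq => //.
  rewrite (_ : _ - _ = c - a); last by ring.
  have [->|->] := cb; first exact: fractB_int.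
  by rewrite (_ : _ - a = (b - a) - 1); [apply: rpredB; [exact: fractB_int|exact: rpred1]|ring].
have mp (c d e : R) : measurable ((fun x : R => x + c) @^-1` (E `&` `[d, e[)).
  by rewrite -[X in measurable X]setTI; apply: measurable_funD => //; exact: measurableI.
rewrite (_ : _ `&` _ = (fun x => x + b) @^-1` (E `&` `[b, 1[) `|`
                       (fun x => x + (b - 1)) @^-1` (E `&` `[0, b[)); last first.
  apply/seteqP; split => x /=; rewrite !in_itv/=.
    move=> [Ex /andP[x0 x1]]; have [xb|xb] := ltP (x + b) 1.
      left; rewrite -(fE x b)//; [|lra|by left].
      by split => //; rewrite (fE x b)//; [lra|lra|left].
    right; rewrite -(fE x (b - 1))//; [|lra|by right].
    by split => //; rewrite (fE x (b - 1))//; [lra|lra|right].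
  case=> -[Ex /andP[x0 x1]].
    by rewrite (fE x b)//; [split => //; lra|lra|left].
  by rewrite (fE x (b - 1))//; [split => //; lra|lra|right].
have mI (d e : R) : measurable (E `&` `[d, e[) by exact: measurableI.
pose lam : {measure set (measurableTypeR R) -> \bar R} := @lebesgue_measure R.
have disjU : [set` `[b, 1[] `&` [set` `[0, b[] = set0 :> set R.
  by apply/seteqP; split => // x /=; rewrite !in_itv/= => -[? ?]; lra.
transitivity (lam ((fun x => x + b)%R @^-1` (E `&` `[b, 1%R[)) +
              lam ((fun x => x + (b - 1))%R @^-1` (E `&` `[0%R, b[)))%E.
  apply: measureU; [exact: mp|exact: mp|].
  by apply/seteqP; split => // x /=; rewrite !in_itv/= => -[[_ ?] [_ ?]]; lra.
transitivity (lam (E `&` `[b, 1%R[) + lam (E `&` `[0%R, b[))%E.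
  by congr (_ + _)%E; exact: lebesgue_shift.
transitivity (lam ((E `&` `[b, 1%R[) `|` (E `&` `[0%R, b[))).
  apply/esym; apply: measureU; [exact: mI|exact: mI|].
  by rewrite setIACA disjU setI0.
congr (lebesgue_measure _); apply/seteqP; split => x /=; rewrite !in_itv/=.
  by case=> -[Ex ?]; split => //; lra.
by move=> [Ex ?]; have [xb|xb] := ltP x b; [right|left]; split => //; lra.
Qed.

Definition torus_measure : set (R * R) -> \bar R :=
  (circle_measure \x circle_measure)%E.

HB.instance Definition _ := Measure.on torus_measure.

Lemma torus_measure_setT : torus_measure setT = 1%E.
Proof.
transitivity (circle_measure setT * circle_measure setT)%E; last first.
  by rewrite circle_measure_setT mule1.
by rewrite /torus_measure -setXTT; exact: product_measure1E.
Qed.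

HB.instance Definition _ :=
  Measure_isProbability.Build _ _ _ torus_measure torus_measure_setT.

Lemma measurable_fractD a : measurable_fun setT (fun x => fract (x + a)).
Proof. by apply: (measurableT_comp measurable_fract); exact: measurable_funD. Qed.

(** By Fubini: each vertical circle is rotated, by an angle that depends on
    the circle, and then the vertical circles are rotated among themselves. *)
Lemma torus_skew a (s : R -> R) (E : set (R * R)) :
  measurable_fun setT s -> measurable E ->
  torus_measure ((fun p => (fract (p.1 + a), fract (p.2 + s p.1))) @^-1` E) =
  torus_measure E.
Proof.
move=> ms mE; rewrite /torus_measure /product_measure1/=.
rewrite (eq_integral (fun x => circle_measure (xsection E (fract (x + a))))); last first.
  move=> x _ /=; have mEx : measurable (xsection E (fract (x + a))).
    exact: measurable_xsection.
  rewrite -[RHS](circle_rotation (s x) mEx).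
  by congr circle_measure; apply/seteqP; split => w /= /set_mem h; apply/mem_set.
have mr := measurable_fractD a.
have mf : measurable_fun setT (fun x => circle_measure (xsection E x)).
  exact: measurable_fun_xsection.
have := @ge0_integral_pushforward _ _ _ _ R _ mr circle_measure setT
  (fun x => circle_measure (xsection E x)) measurableT mf (fun _ _ => measure_ge0 _ _).
rewrite preimage_setT => <-.
by apply: eq_measure_integral => A mA _; exact: circle_rotation.
Qed.

End CircleMeasure.

(** * Invariant measures in a chart *)
Lemma image_probability d d' (T : measurableType d) (T' : measurableType d')
    (R : realType) (P : probability T R) (f : T -> T') :
  measurable_fun setT f ->
  exists Q : probability T' R, forall B, Q B = P (f @^-1` B).
Proof.
move=> mf; pose f' : {mfun T >-> T'} := HB.pack f (isMeasurableFun.Build _ _ _ _ f mf).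
by exists (distribution P f').
Qed.

Section ChartMeasure.
Context {R : realType} {Y : ptopologicalType}.
Variables (X W : Y -> R) (F : R * R -> Y).

Hypothesis chart : torus_chart X W F.

Lemma chart_measurable : measurable_fun setT (F : R * R -> borel Y).
Proof. exact: continuous_borel_prod (chart_cont chart). Qed.

Lemma chart_preimage_measurable (B : set (borel Y)) :
  measurable B -> measurable (F @^-1` B).
Proof. by move=> mB; rewrite -[X in measurable X]setTI; exact: chart_measurable. Qed.

Lemma chart_fract p : F (fract p.1, fract p.2) = F p.
Proof.
rewrite -[RHS](chart_periodic chart p (fractB_int p.1) (fractB_int p.2)).
by rewrite !(addrC _ (fract _ - _)) !subrK.
Qed.

Lemma chart_XE (x w : R) : 0 <= x < 1 -> X (F (x, w)) = x.
Proof.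
move=> x01; rewrite -[RHS](@fract_uniq R x x)//; last by rewrite subrr rpred0.
by apply/esym/fract_uniq; [exact: chart_X chart _|exact: (chart_XF chart (x, w))].
Qed.

Lemma chart_WE (x w : R) : 0 <= w < 1 -> W (F (x, w)) = w.
Proof.
move=> w01; rewrite -[RHS](@fract_uniq R w w)//; last by rewrite subrr rpred0.
by apply/esym/fract_uniq; [exact: chart_W chart _|exact: (chart_WF chart (x, w))].
Qed.

Section Measure.
Variable mu : probability (borel Y) R.
Hypothesis muE : forall B, mu B = torus_measure (F @^-1` B).

Lemma chart_measure_preserving (T : Y -> Y) a (s : R -> R) :
  measurable_fun setT (T : borel Y -> borel Y) -> measurable_fun setT s ->
  (forall x w, T (F (x, w)) = F (x + a, w + s x)) ->
  measure_preserving mu (T : borel Y -> borel Y).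
Proof.
move=> mT ms TF; split => // B mB.
rewrite !muE -(torus_skew a ms (chart_preimage_measurable mB)).
congr torus_measure; apply/seteqP; split => -[x w] /=; rewrite TF.
  by rewrite -[F (fract _, _)]/(F (fract (x + a, w + s x).1, fract (x + a, w + s x).2)) chart_fract.
by rewrite -[F (fract _, _)]/(F (fract (x + a, w + s x).1, fract (x + a, w + s x).2)) chart_fract.
Qed.

Lemma chart_measure_box (a b c d : R) : 0 <= a -> a < b -> b <= 1 ->
  0 <= c -> c < d -> d <= 1 ->
  0 < fine (mu ([set y | a < X y < b] `&` [set y | c < W y < d])).
Proof.
move=> a0 ab b1 c0 cd d1.
set E := _ `&` _; have mE : measurable (E : set (borel Y)).
  apply: (trig_set_measurable chart); apply: trig_setI.
    by apply: trig_set_arc (ltW ab) b1 => //; [exact: chart_X chart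
      |move=> n; exact: trigpoly_arc_step1].
  by apply: trig_set_arc (ltW cd) d1 => //; [exact: chart_W chart
    |move=> n; exact: trigpoly_arc_step2].
rewrite fine_gt0//; apply/andP; split; last first.
  by rewrite (le_lt_trans (probability_le1 _ _)) ?ltry.
rewrite muE; apply: (@lt_le_trans _ _ (torus_measure (`]a, b[%classic `*` `]c, d[%classic))).
  have ciE (u v : R) : 0 <= u -> u < v -> v <= 1 -> (0 < circle_measure `]u, v[%classic)%E.
    move=> u0 uv v1; rewrite /circle_measure /mrestr setIidl; last first.
      by move=> x /=; rewrite !in_itv/=; lra.
    by rewrite lebesgue_measure_itv/= lte_fin uv -EFinB lte_fin subr_gt0.
  have -> : torus_measure (`]a, b[%classic `*` `]c, d[%classic) =
            (circle_measure `]a, b[%classic * circle_measure `]c, d[%classic)%E.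
    by apply: product_measure1E; exact: measurable_itv.
  by rewrite mule_gt0// ciE.
apply: le_measure; rewrite ?inE.
- by apply: measurableX; exact: measurable_itv.
- exact: chart_preimage_measurable.
- move=> [x w] /=; rewrite !in_itv/= => -[xab wcd].
  by rewrite /E/= chart_XE ?chart_WE//; lra.
Qed.

End Measure.

Section SkewTranslation.
Variables (T : Y -> Y) (al del : R).
Hypothesis irr : forall j : int, j != 0 -> j%:~R * al \isn't a Num.int.
Hypothesis TF : forall x w, T (F (x, w)) = F (x + al, w - x + del).

Let XT y : X (T y) - (X y + al) \is a Num.int.
Proof. by rewrite -[y in T y](chart_K chart) TF; exact: (chart_XF chart). Qed.

Let WT y : W (T y) - (W y - X y + del) \is a Num.int.
Proof. by rewrite -[y in T y](chart_K chart) TF; exact: (chart_WF chart). Qed.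

Lemma chart_invariant_unique (m m' : probability (borel Y) R) :
  measure_preserving m (T : borel Y -> borel Y) ->
  measure_preserving m' (T : borel Y -> borel Y) ->
  forall B : set (borel Y), measurable B -> m B = m' B.
Proof.
move=> pm pm'; apply: (trig_determines chart) => f tf.
exact: (mean_unique XT WT irr (mean_Rintegral chart XT WT pm) (mean_Rintegral chart XT WT pm')).
Qed.

End SkewTranslation.
End ChartMeasure.

(** * Minimality *)
Lemma ultra_fmap (T U : Type) (f : T -> U) (G : set_system T) :
  UltraFilter G -> UltraFilter (f @ G).
Proof.
move=> GU; have pG : ProperFilter G := @ultra_proper _ _ GU.
split; first exact: fmap_proper_filter.
move=> H pH GH; apply/seteqP; split => // A HA.
have [//|GAc] := in_ultra_setVsetC (f @^-1` A) GU.
have HAc : H (~` A) by apply: GH; exact: GAc.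
by have := filter_ex (filterI HA HAc); case=> x [].
Qed.

Lemma ultra_cvg_bounded (R : realType) (T : Type) (G : set_system T) (u : T -> R) M :
  UltraFilter G -> (forall n, `|u n| <= M) -> cvg (u @ G).
Proof.
move=> GU uM; have uG := ultra_fmap u GU.
have pG : ProperFilter G := @ultra_proper _ _ GU.
have := @segment_compact R (- M) M; rewrite compact_ultra => /(_ _ uG).
case=> [|p [_ up]]; last by apply/cvg_ex; exists p.
by apply: nearW => n /=; rewrite in_itv/= -ler_norml.
Qed.

Section OrbitMean.
Context {R : realType} {Y : Type}.
Variables (X W : Y -> R) (T : Y -> Y).

Definition orbit_average (q : Y) (f : Y -> R) (N : nat) :=
  N.+1%:R^-1 * \sum_(n < N.+1) f (iter n T q).

Lemma orbit_average_le q f c N : (forall n, f (iter n T q) <= c) ->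
  orbit_average q f N <= c.
Proof.
move=> fc; rewrite /orbit_average mulrC ler_pdivrMr// mulr_natr.
rewrite -[X in _ *+ X](card_ord N.+1) -sumr_const; exact: ler_sum.
Qed.

Lemma orbit_average_ge q f c N : (forall n, c <= f (iter n T q)) ->
  c <= orbit_average q f N.
Proof.
move=> fc; rewrite /orbit_average mulrC ler_pdivlMr// mulr_natr.
rewrite -[X in _ *+ X](card_ord N.+1) -sumr_const; exact: ler_sum.
Qed.

(** The bounded sequence of the averages of [f] along the orbit converges along
    an ultrafilter finer than the neighborhoods of infinity.  The limit is
    invariant, because the averages of [f] and of [f o T] over [N + 1] points
    differ by at most [2 * M / (N + 1)], with [M] a bound of [f]. *)
Lemma exists_orbit_mean (q : Y) : exists L : (Y -> R) -> R, mean X W T L /\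
  forall f c, trigpoly X W f -> (forall n, f (iter n T q) <= c) -> L f <= c.
Proof.
have [G [GU ooG]] := @ultraFilterLemma nat \oo _.
have pG : ProperFilter G := @ultra_proper _ _ GU.
pose L f : R := lim (orbit_average q f @ G).
have Lcvg f : trigpoly X W f -> orbit_average q f @ G --> L f.
  move=> tf; have [M M0 fM] := trigpoly_bounded tf.
  suff : cvg (orbit_average q f @ G) by [].
  apply: (ultra_cvg_bounded (M := M)) => N; rewrite ler_norml.
  have h n := fM (iter n T q).
  apply/andP; split.
    by apply: orbit_average_ge => n; have := h n; rewrite ler_norml => /andP[].
  by apply: orbit_average_le => n; have := h n; rewrite ler_norml => /andP[].
have LE f l : orbit_average q f @ G --> l -> L f = l by move=> /cvg_lim; apply.
exists L; split; last first.
  by move=> f c tf fc; apply: (cvgr_to_le (Lcvg _ tf)); apply: nearW => N; exact: orbit_average_le.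
split => [f g tf tg|c f tf|f tf f0||f tf].
- apply: LE; rewrite (_ : orbit_average q _ = orbit_average q f \+ orbit_average q g).
    by apply: cvgD; exact: Lcvg.
  by apply/funext => N; rewrite /orbit_average/= big_split mulrDr.
- apply: LE; rewrite (_ : orbit_average q _ = (fun N => c * orbit_average q f N)).
    by apply: cvgMr; exact: Lcvg.
  by apply/funext => N; rewrite /orbit_average/= -mulr_sumr mulrCA.
- by apply: (cvgr_to_ge (Lcvg _ tf)); apply: nearW => N; exact: orbit_average_ge.
- apply: LE; rewrite (_ : orbit_average q _ = cst 1); first exact: cvg_cst.
  apply/funext => N; apply/eqP; rewrite eq_le.
  by rewrite orbit_average_le ?orbit_average_ge.
- apply: LE; have [M M0 fM] := trigpoly_bounded tf.
  rewrite (_ : orbit_average q (f \o T) = fun N => orbit_average q f N +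
      N.+1%:R^-1 * (f (iter N.+1 T q) - f q)).
    rewrite -[X in _ --> X]addr0; apply: cvgD; first exact: Lcvg.
    have : (fun N => N.+1%:R^-1 * (f (iter N.+1 T q) - f q)) @ \oo --> (0 : R).
      apply: (@squeeze_cvgr _ _ _ _ (fun N => - (harmonic N * (2 * M)))
                                    (fun N => harmonic N * (2 * M))).
      + apply: nearW => N; rewrite -ler_norml normrM ger0_norm// ler_wpM2l//.
        by rewrite (le_trans (ler_normB _ _))// mulr_natl mulr2n lerD.
      + rewrite -oppr0 -(mul0r (2 * M)); apply: cvgN; apply: cvgMl.
        exact: cvg_harmonic.
      + by rewrite -(mul0r (2 * M)); apply: cvgMl; exact: cvg_harmonic.
    by apply: cvg_trans; apply: cvg_app.
  apply/funext => N; rewrite /orbit_average -mulrDr; congr (_ * _).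
  have shift : \sum_(n < N.+1) f (iter n.+1 T q) + f q =
               \sum_(n < N.+1) f (iter n T q) + f (iter N.+1 T q).
    by rewrite -(big_ord_recr N.+1 (fun n => f (iter n T q))) big_ord_recl addrC.
  by rewrite addrA -shift addrK.
Qed.

End OrbitMean.

Section Minimality.
Context {R : realType} {Y : ptopologicalType}.
Variables (X W : Y -> R) (F : R * R -> Y).
Hypothesis chart : torus_chart X W F.
Variable mu : probability (borel Y) R.
Hypothesis muE : forall B, mu B = torus_measure (F @^-1` B).
Variables (T : Y -> Y) (al del : R).
Hypothesis irr : forall j : int, j != 0 -> j%:~R * al \isn't a Num.int.
Hypothesis TF : forall x w, T (F (x, w)) = F (x + al, w - x + del).
Hypothesis muT : measure_preserving mu (T : borel Y -> borel Y).

(** The corner of the box is a point of [O], so that the box stays inside the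
    fundamental square. *)
Lemma open_box (O : set Y) : open O -> O !=set0 ->
  exists a b c d : R, [/\ 0 <= a /\ a < b, b <= 1, 0 <= c /\ c < d, d <= 1 &
    [set y | a < X y < b] `&` [set y | c < W y < d] `<=` O].
Proof.
move=> oO [y Oy].
have oFO : open (F @^-1` O) by move/continuousP : (chart_cont chart); exact.
have /nbhs_ballP[e/= e0 eO] : nbhs (X y, W y) (F @^-1` O).
  by apply: open_nbhs_nbhs; split => //=; rewrite (chart_K chart).
have /andP[x0 x1] := chart_X chart y; have /andP[w0 w1] := chart_W chart y.
exists (X y), (Num.min 1 (X y + e)), (W y), (Num.min 1 (W y + e)).
rewrite !lt_min !ge_min !lexx/= x0 x1 w0 w1 !ltrDl e0; split => // z [/=].
rewrite !lt_min => /andP[xz /andP[_ zx]] /andP[wz /andP[_ zw]].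
rewrite -(chart_K chart z); apply: eO; split; rewrite /= /ball/= ltr_norml;
  apply/andP; split; lra.
Qed.

(** On [G], which misses the box, one of the two step factors is at most
    [1 / (n + 1)]; the integral of their product tends to the measure of the
    box. *)
Lemma chart_minimal : minimal T.
Proof.
move=> G cG [q Gq] TG; apply/eqP/negPn/negP => GT.
have GTq n : G (iter n T q) by elim: n => // n IH; apply: TG; exists (iter n T q).
have [a [b [c [d [[a0 ab] b1 [c0 cd] d1 boxO]]]]] : exists a b c d : R,
    [/\ 0 <= a /\ a < b, b <= 1, 0 <= c /\ c < d, d <= 1 &
    [set y | a < X y < b] `&` [set y | c < W y < d] `<=` ~` G].
  apply: open_box; first exact: closed_openC.
  by apply/set0P; apply: contra GT => /eqP GC; rewrite -(setCK G) GC setC0.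
have XT y : X (T y) - (X y + al) \is a Num.int.
  by rewrite -[y in T y](chart_K chart) TF; exact: (chart_XF chart).
have WT y : W (T y) - (W y - X y + del) \is a Num.int.
  by rewrite -[y in T y](chart_K chart) TF; exact: (chart_WF chart).
have [L [mL Lle]] := exists_orbit_mean X W T q.
pose f n y := arc_step n a b (X y) * arc_step n c d (W y).
have tf n : trigpoly X W (f n).
  by apply: trigpolyM; [exact: trigpoly_arc_step1|exact: trigpoly_arc_step2].
have f01 n y : 0 <= f n y <= 1.
  have /andP[? ?] := arc_step_itv n a b (X y).
  have /andP[? ?] := arc_step_itv n c d (W y).
  by rewrite mulr_ge0//= mulr_ile1.
have := @cvg_trig_set _ _ _ _ _ chart mu ([set y | a < X y < b] `&` [set y | c < W y < d]) f tf f01.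
have := chart_measure_box chart muE a0 ab b1 c0 cd d1.
set E := _ `&` _ => E0 cvgf.
have : fine (mu E) <= 0; last by rewrite leNgt E0.
have fG n k : f n (iter k T q) <= n.+1%:R^-1.
  have /andP[s0 s1] := arc_step_itv n a b (X (iter k T q)).
  have /andP[t0 t1] := arc_step_itv n c d (W (iter k T q)).
  have [xab|xab] := boolP (a < X (iter k T q) < b); last first.
    rewrite (@le_trans _ _ (arc_step n a b (X (iter k T q))))//; first by rewrite ler_piMr.
    by apply: arc_step_le => //; [exact: ltW|exact: chart_X chart _].
  have [wcd|wcd] := boolP (c < W (iter k T q) < d); last first.
    rewrite (@le_trans _ _ (arc_step n c d (W (iter k T q))))//; first by rewrite ler_piMl.
    by apply: arc_step_le => //; [exact: ltW|exact: chart_W chart _].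
  by exfalso; apply: (boxO (iter k T q)).
have muf : (\int[mu]_y f n y)%R @[n --> \oo] --> fine (mu E).
  apply: cvgf => y; rewrite /E indicI; apply: cvgM.
    rewrite indicE (_ : (y \in _) = (a < X y < b)).
      by apply: cvg_arc_step => //; [exact: ltW|exact: chart_X chart _].
    by apply/idP/idP => [/set_mem|/mem_set].
  rewrite indicE (_ : (y \in _) = (c < W y < d)).
    by apply: cvg_arc_step => //; [exact: ltW|exact: chart_W chart _].
  by apply/idP/idP => [/set_mem|/mem_set].
apply: (ler_cvg_to muf (@cvg_harmonic R)); apply: nearW => n.
rewrite -(mean_unique XT WT irr mL (mean_Rintegral chart XT WT muT) (tf n)).
exact: Lle.
Qed.

End Minimality.

(** * The nilmanifold as a torus *)
Lemma continuous_pair (T U V : topologicalType) (f : T -> U) (g : T -> V) :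
  continuous f -> continuous g -> continuous (fun x => (f x, g x)).
Proof. by move=> cf cg x; exact: (cvg_pair (cf x) (cg x)). Qed.

Section NilmanifoldChart.
Context {R : realType}.
Implicit Types (g h : heis R) (x y : slice R) (q : nilmanifold R).

Lemma int_bin2 (i : R) : i \is a Num.int -> i * (i - 1) / 2 \is a Num.int.
Proof.
have nat_bin2 (n : nat) : n%:R * (n%:R - 1) / 2 \is a @Num.int R.
  case: n => [|n]; first by rewrite !mul0r rpred0.
  rewrite -natr1 addrK natr1 -natrM (_ : (n.+1 * n)%N = 'C(n.+1, 2) * 2)%N.
    by rewrite natrM mulfK ?rpred_nat// pnatr_eq0.
  by rewrite bin2 muln2 -divn2 -muln2 divnK// dvdn2 oddM/= andNb.
move=> /intrP[j ->]; case: (intP j) => [|n|n]; first exact: (nat_bin2 0).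
  exact: nat_bin2.
rewrite (_ : _ / 2 = n.+2%:R * (n.+2%:R - 1) / 2); first exact: nat_bin2.
by rewrite mulrNz -pmulrn -[n.+2%:R]natr1; field.
Qed.

(** The second coordinate of the torus.  Normalizing an element of the subgroup
    by a right multiplication by [[0, -(x + y), 0]] makes [y = - x] and
    replaces [z] by [z - (x + y) * x]; the quadratic term then makes the result
    invariant modulo 1 under [x |-> x + 1], thanks to [int_bin2]. *)
Definition hw g := hz g - (hx g + hy g) * hx g + hx g * (hx g - 1) / 2.

Lemma slice_int x : hx (val x) + hy (val x) \is a Num.int.
Proof. by have := valP x; rewrite inE. Qed.

(** The nilmanifold is the two-dimensional torus: with [i = x' - x] and
    [k' = x' + y'], the central coordinate of the quotient of two elements
    is [w' - w + k' * i - i * (i - 1) / 2]. *)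
Lemma coset_eqE x y : coset_eq x y =
  (hx (val y) - hx (val x) \is a Num.int) && (hw (val y) - hw (val x) \is a Num.int).
Proof.
have := slice_int x; have := slice_int y.
rewrite /coset_eq val_divl inE /hw.
case: (val x) => -[a b] c; case: (val y) => -[a' b'] c'.
rewrite /hx /hy /hz/= => k'Z kZ.
rewrite (addrC (- a)); set i := a' - a.
rewrite (_ : - b + b' = (a' + b') - (a + b) - i); last by rewrite /i; ring.
have [iZ|] /= := boolP (i \is a Num.int); last by [].
have -> /= : a' + b' - (a + b) - i \is a Num.int by apply: rpredB => //; exact: rpredB.
rewrite (_ : _ + - a * b' = c' - (a' + b') * a' + a' * (a' - 1) / 2 -
  (c - (a + b) * a + a * (a - 1) / 2) + ((a' + b') * i - i * (i - 1) / 2)); last first.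
  by rewrite /i /hx /hy/=; field.
by rewrite rpredDr//; apply: rpredB; [apply: rpredM|exact: int_bin2].
Qed.

Lemma eq_piE x y : (\pi_(nilmanifold R) x = \pi_(nilmanifold R) y) <->
  (hx (val y) - hx (val x) \is a Num.int) /\ (hw (val y) - hw (val x) \is a Num.int).
Proof.
split=> [/eqmodP/=|xy]; first by rewrite -/(coset_eq x y) coset_eqE => /andP.
by apply/eqmodP; rewrite /= coset_eqE; apply/andP.
Qed.

Lemma slice_pt_subproof (p : R * R) :
  Heis p.1 (- p.1) (p.2 - p.1 * (p.1 - 1) / 2) \in slice_pred R.
Proof. by rewrite inE /hx /hy/= subrr rpred0. Qed.

Definition slice_pt p : slice R :=
  Sub (Heis p.1 (- p.1) (p.2 - p.1 * (p.1 - 1) / 2)) (slice_pt_subproof p).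

Lemma hx_slice_pt p : hx (val (slice_pt p)) = p.1. Proof. by []. Qed.

Lemma hw_slice_pt p : hw (val (slice_pt p)) = p.2.
Proof. by rewrite /hw /hx /hy /hz/=; ring. Qed.

Definition nilF (p : R * R) : nilmanifold R := \pi_(nilmanifold R) (slice_pt p).
Definition nilX q := fract (hx (val (repr q))).
Definition nilW q := fract (hw (val (repr q))).

Lemma pi_nilF x : \pi_(nilmanifold R) x = nilF (hx (val x), hw (val x)).
Proof.
by apply/eq_piE; rewrite hx_slice_pt hw_slice_pt !subrr rpred0.
Qed.

Lemma repr_pi x : let y := repr (\pi_(nilmanifold R) x) in
  (hx (val y) - hx (val x) \is a Num.int) /\ (hw (val y) - hw (val x) \is a Num.int).
Proof. by apply/eq_piE; rewrite reprK. Qed.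

Lemma nilX_pi x : nilX (\pi_(nilmanifold R) x) - hx (val x) \is a Num.int.
Proof.
have [h _] := repr_pi x; rewrite /nilX; set y := repr _ in h *.
by rewrite -(subrK (hx (val y)) (fract _)) -addrA rpredD// fractB_int.
Qed.

Lemma nilW_pi x : nilW (\pi_(nilmanifold R) x) - hw (val x) \is a Num.int.
Proof.
have [_ h] := repr_pi x; rewrite /nilW; set y := repr _ in h *.
by rewrite -(subrK (hw (val y)) (fract _)) -addrA rpredD// fractB_int.
Qed.

Lemma continuous_slice_pt : continuous slice_pt.
Proof.
apply: continuous_comp_initial => p.
have c1 : continuous (fun p : R * R => p.1) by move=> ?; exact: cvg_fst.
have c2 : continuous (fun p : R * R => p.2) by move=> ?; exact: cvg_snd.
have cf : continuous (fun p : R * R => (p.1, - p.1, p.2 - p.1 * (p.1 - 1) / 2)).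
  apply: continuous_pair.
    by apply: continuous_pair => // x; apply: cvgN; exact: c1.
  move=> x; apply: cvgB; first exact: c2.
  by apply: cvgMl; apply: cvgM; [exact: c1|apply: cvgB; [exact: c1|exact: cvg_cst]].
exact: cf.
Qed.

Lemma nil_chart : torus_chart nilX nilW nilF.
Proof.
split => [q|q|q|p|p|p u v uZ vZ||j l th].
- exact: fract_itv.
- exact: fract_itv.
- rewrite -[RHS]reprK; apply/eq_piE; rewrite hx_slice_pt hw_slice_pt /nilX /nilW.
  by rewrite -!(opprB (fract _)) !rpredN !fractB_int.
- by have := nilX_pi (slice_pt p); rewrite hx_slice_pt.
- by have := nilW_pi (slice_pt p); rewrite hw_slice_pt.
- apply/eq_piE; rewrite !hx_slice_pt !hw_slice_pt/= !opprD !addNKr.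
  by rewrite !rpredN.
- by move=> p; apply: continuous_comp; [exact: continuous_slice_pt|exact: pi_continuous].
- apply/quotient_continuous.
  rewrite (_ : _ \o _ = fun x => cos2pi (j%:~R * hx (val x) + l%:~R * hw (val x) + th)).
    have cc (f : heis R -> R) : continuous f -> continuous (f \o (val : slice R -> heis R)).
      by move=> cf x; apply: continuous_comp; [exact: initial_continuous|exact: cf].
    apply: (cc (fun g => cos2pi (j%:~R * hx g + l%:~R * hw g + th))) => g.
    have c1 : @hx R @ g --> hx g by apply: cvg_comp cvg_fst _; exact: cvg_fst.
    have c2 : @hy R @ g --> hy g by apply: cvg_comp cvg_fst _; exact: cvg_snd.
    have c3 : @hz R @ g --> hz g by exact: cvg_snd.
    pose f (g : heis R) := j%:~R * hx g + l%:~R * hw g + th.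
    have cf : f @ g --> f g.
      apply: cvgD; last exact: cvg_cst.
      apply: cvgD; apply: cvgMr => //.
      apply: cvgD; first by apply: cvgB => //; apply: cvgM => //; exact: cvgD.
      by apply: cvgMl; apply: cvgM => //; apply: cvgB => //; exact: cvg_cst.
    have ccos : continuous (@cos2pi R).
      by move=> t; apply: continuous_comp; [apply: cvgMl; exact: cvg_id|exact: continuous_cos].
    exact: (cvg_comp _ _ cf (ccos (f g))).
  apply/funext => x /=; rewrite /chr.
  rewrite (_ : _ + th = j%:~R * hx (val x) + l%:~R * hw (val x) + th +
    (j%:~R * (nilX (\pi x) - hx (val x)) +
     l%:~R * (nilW (\pi x) - hw (val x)))); last by ring.
  by rewrite cos2piDint// rpredD// rpredM ?intr_int// ?nilX_pi ?nilW_pi.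
Qed.

(** The quadratic term of [hw] cancels the product [a * x] coming from the group
    law, so that the slope of the skew translation is the integer [k]. *)
Lemma niltranslation_nilF (g : slice R) (x w : R) :
  let k := hx (val g) + hy (val g) in
  niltranslation g (nilF (x, w)) =
  nilF (x + hx (val g),
        w - k * x +
          (hz (val g) - k * hx (val g) + hx (val g) * (hx (val g) - 1) / 2)).
Proof.
move=> k; rewrite niltranslationE pi_nilF; congr nilF; rewrite /k /hw /=.
case: (val g) => -[a b] c; rewrite /hx /hy /hz/= /hx /hy /hz/=.
by congr (_, _); [ring|field].
Qed.

End NilmanifoldChart.

(** * Self-induction from a conjugacy *)
Section Induction.
Context {R : realType} {d : measure_display} {Y : measurableType d}.
Implicit Types (T : Y -> Y) (A B : set Y).

Lemma is_return_time_uniq T A y n n' :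
  is_return_time T A y n -> is_return_time T A y n' -> n = n'.
Proof.
move=> [n0 An nA] [n'0 An' n'A]; case: (ltngtP n n') => // h; exfalso.
  by apply: (n'A n) => //; rewrite n0.
by apply: (nA n') => //; rewrite n'0.
Qed.

Lemma first_returnE T A y n : is_return_time T A y n -> first_return T A y = iter n T y.
Proof.
move=> yn; rewrite /first_return; congr (iter _ T y).
by apply: (is_return_time_uniq (T := T) (A := A) (y := y)) => //; apply: xgetPex; exists n.
Qed.

Variables (mu : probability Y R) (T T' : Y -> Y).
Hypothesis mT : measurable_fun setT T.
Hypothesis mT' : measurable_fun setT T'.
Hypothesis TK : cancel T T'.
Hypothesis T'K : cancel T' T.
Hypothesis muT : forall B, measurable B -> mu (T @^-1` B) = mu B.
Hypothesis unique : forall nu : probability Y R, measure_preserving nu T ->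
  forall B, measurable B -> nu B = mu B.

Variables (Phi Psi : Y -> Y) (A : set Y).
Hypothesis mPhi : measurable_fun setT Phi.
Hypothesis mPsi : measurable_fun setT Psi.
Hypothesis mA : measurable A.
Hypothesis PhiK : cancel Phi Psi.
Hypothesis APhi : forall y, A (Phi y).
Hypothesis PsiK : forall y, A y -> Phi (Psi y) = y.
Hypothesis return_Phi : forall y,
  exists2 n, is_return_time T A (Phi y) n & iter n T (Phi y) = Phi (T y).
Hypothesis hit : forall y, exists n, A (iter n T y).
Hypothesis spaced : A `&` T @^-1` A = set0.

Let measurable_iter (f : Y -> Y) n : measurable_fun setT f ->
  measurable_fun setT (iter n f).
Proof.
move=> mf; elim: n => [|n IH]; first exact: measurable_id.
exact: (measurableT_comp mf IH).
Qed.

Let measurable_preimage (f : Y -> Y) B : measurable_fun setT f -> measurable B ->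
  measurable (f @^-1` B).
Proof. by move=> mf mB; rewrite -[X in measurable X]setTI; exact: mf. Qed.

Let mu_iter n B : measurable B -> mu (iter n T @^-1` B) = mu B.
Proof.
elim: n B => [//|n IH B mB]; rewrite -[RHS]muT// -[RHS]IH//.
exact: measurable_preimage.
Qed.

(** The preimages of [A] under the iterates of [T] cover the space. *)
Let muA_gt0 : (0 < mu A)%E.
Proof.
rewrite lt0e measure_ge0 andbT; apply/eqP => muA.
have mTA n : measurable (iter n T @^-1` A).
  by apply: measurable_preimage => //; exact: measurable_iter.
have : mu (\bigcup_n (iter n T @^-1` A)) = 0%E.
  apply: measure_negligible; first exact: bigcupT_measurable.
  apply: negligible_bigcup => n; apply/negligibleP => //.
  exact: etrans (mu_iter n mA) muA.
rewrite (_ : \bigcup_n _ = setT); last first.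
  by apply/seteqP; split => // y _; have [n An] := hit y; exists n.
by move/eqP; rewrite probability_setT onee_eq0.
Qed.

Let muA_lt1 : (mu A < 1)%E.
Proof.
rewrite lt_neqAle probability_le1// andbT; apply/eqP => muA.
have mTA : measurable (T @^-1` A) by exact: measurable_preimage.
have : (mu (A `|` T @^-1` A) <= 1)%E by apply: probability_le1; exact: measurableU.
rewrite (_ : mu _ = mu A + mu (T @^-1` A))%E; last exact: measureU.
by rewrite (muT mA) muA -EFinD lee_fin; lra.
Qed.

Let iterK n : cancel (iter n T) (iter n T').
Proof. by elim: n => [//|n IH] y; rewrite iterSr iterS TK IH. Qed.

Let iterK' n : cancel (iter n T') (iter n T).
Proof. by elim: n => [//|n IH] y; rewrite iterSr iterS T'K IH. Qed.

Let level n := A `&` [set y | is_return_time T A y n].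

Let level_measurable n : measurable (level n).
Proof.
rewrite /level; case: (posnP n) => [->|n0].
  rewrite (_ : [set _ | _] = set0) ?setI0//.
  by apply/seteqP; split => // y [].
apply: measurableI => //.
rewrite (_ : [set _ | _] = (iter n T @^-1` A) `&`
   \bigcap_(k in [set k | (0 < k < n)%N]) (iter k T @^-1` (~` A))).
  apply: measurableI; first by apply: measurable_preimage => //; exact: measurable_iter.
  apply: bigcap_measurableType => k _; apply: measurable_preimage.
    exact: measurable_iter.
  exact: measurableC.
by apply/seteqP; split => y /= [] // ? ?; split.
Qed.

(** The first return map of [A] preserves the restriction of [mu]: it acts by
    [T ^ n] on the level [n], and its images of the levels form a partition of
    [A].  They are disjoint because two points of [A] on the same orbit with a
    common image would contradict the minimality of a return time. *)
Let return_invariant B : measurable B ->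
  mu (A `&` Psi @^-1` (T @^-1` B)) = mu (A `&` Psi @^-1` B).
Proof.
move=> mB; set E := A `&` Psi @^-1` B.
have mE : measurable E by apply: measurableI => //; exact: measurable_preimage.
have stepE y n : A y -> is_return_time T A y n -> E (iter n T y) = B (T (Psi y)).
  move=> Ay yn; have [n' yn' TPhi] := return_Phi (Psi y).
  move: yn' TPhi; rewrite PsiK// => yn'; rewrite -(is_return_time_uniq yn yn') => TPhi.
  by rewrite TPhi /E/= PhiK; apply/propext; split => [[]|].
pose G n := level n `&` iter n T @^-1` E.
pose H n := iter n T' @^-1` level n `&` E.
have GU : A `&` Psi @^-1` (T @^-1` B) = \bigcup_n G n.
  apply/seteqP; split => [y [Ay By]|y [n _ [[Ay yn] Ey]]].
    have [n yn _] := return_Phi (Psi y); rewrite PsiK// in yn.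
    by exists n => //; split; [split|rewrite /= stepE].
  by split => //; move: Ey; rewrite /= stepE.
have HU : E = \bigcup_n H n.
  apply/seteqP; split => [y Ey|y [n _ []]//].
  have [n pn TPhi] := return_Phi (T' (Psi y)).
  exists n => //; split => //; rewrite /level/=.
  have -> : iter n T' y = Phi (T' (Psi y)).
    by rewrite -[RHS](iterK n) TPhi T'K PsiK//; case: Ey.
  by split.
have mG n : measurable (G n).
  apply: measurableI => //; apply: measurable_preimage => //.
  exact: measurable_iter.
have mH n : measurable (H n).
  apply: measurableI => //; apply: measurable_preimage => //.
  exact: measurable_iter.
have tG : trivIset setT G.
  apply/trivIsetP => i j _ _ ij; apply/seteqP; split => // y [[[_ yi] _] [[_ yj] _]].
  by move/eqP : ij; apply; exact: is_return_time_uniq yi yj.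
have HH i j y : (i < j)%N -> H i y -> H j y -> False.
  move=> ij [[Ai [i0 _ _]] _] [[_ [j0 _ nAj]] _].
  apply: (nAj (j - i)%N); first by rewrite subn_gt0 ij ltn_subrL i0 j0.
  by rewrite -[j in iter j T' _](subnK (ltnW ij)) iterD iterK'.
have tH : trivIset setT H.
  apply/trivIsetP => i j _ _; rewrite neq_ltn => /orP[] ij; apply/seteqP; split => // y [].
    exact: HH ij.
  by move=> ? ?; apply: (HH j i y ij).
rewrite GU HU !measure_bigcup//; apply: eq_eseriesr => n _.
apply: etrans (mu_iter n (mH n)); congr (mu _); apply/seteqP; split => y /= [].
  by move=> yn Ey; split => //=; rewrite iterK.
by rewrite /= iterK.
Qed.

(** Transporting the normalized restriction of [mu] to [A] by [Psi] gives a
    [T]-invariant probability, as [Psi] intertwines the first return map with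
    [T]; the uniqueness of the invariant probability identifies it with [mu]. *)
Lemma self_induced_of_conjugacy : self_induced mu T.
Proof.
split; first by split.
have Afin : mu A \is a fin_num by exact: fin_num_measure.
exists A; split => //; first by rewrite [X in (_ < X)%E]probability_setT.
have normT B : normalized_restriction mu setT B = mu B.
  by rewrite /normalized_restriction setIT [mu setT]probability_setT/= invr1 mule1.
pose rho : {measure set Y -> \bar R} := [the {measure set Y -> \bar R} of mrestr mu mA].
have rhoE B : mnormalize rho mu B = normalized_restriction mu A B.
  rewrite /mnormalize /rho/= /mrestr setTI /normalized_restriction.
  by rewrite gt_eqF//= lt_eqF// ltey_eq Afin.
have [nu nuE'] := image_probability (mnormalize rho mu) mPsi.
have nuE B : nu B = normalized_restriction mu A (Psi @^-1` B).
  by rewrite nuE'; exact: rhoE.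
have nuT : measure_preserving nu T.
  split => // B mB; rewrite !nuE /normalized_restriction; congr (_ * _)%E.
  by rewrite setIC return_invariant// setIC.
exists A, setT, Psi; split.
- split => //.
  + move=> y Ay; split => //; have [n yn _] := return_Phi (Psi y).
    by exists n; rewrite PsiK// in yn.
  + by rewrite /normalized_restriction setICl measure0 mul0e.
  + move=> _ [y Ay <-]; have [n yn TPhi] := return_Phi (Psi y).
    by move: yn TPhi; rewrite PsiK// => yn TPhi; rewrite (first_returnE yn) TPhi.
- by split => //; rewrite setCT normT measure0.
- split => //.
  + move=> y y' /set_mem Ay /set_mem Ay' e.
    by rewrite -(PsiK Ay) -(PsiK Ay') e.
  + by move=> y _; exists (Phi y).
- split => [B mB _|B mB BA]; last first.
    rewrite (_ : _ @` _ = Phi @^-1` B); first exact: measurable_preimage.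
    apply/seteqP; split => [_ [y By <-]|y By] /=; first by rewrite PsiK//; exact: BA.
    by exists (Phi y).
  split; first by apply: measurableI => //; exact: measurable_preimage.
  rewrite normT -(unique nuT mB) nuE /normalized_restriction.
  by rewrite setIAC setIid setIC.
- move=> y /set_mem Ay; have [n yn TPhi] := return_Phi (Psi y).
  by move: yn TPhi; rewrite PsiK// => yn TPhi; rewrite (first_returnE yn) TPhi PhiK.
Qed.

End Induction.

(** * Automorphisms of the Heisenberg group renormalizing a flow *)
Lemma heis_mulE (R : realType) (g h : heis R) : (g * h)%g =
  Heis (hx g + hx h) (hy g + hy h) (hz g + hz h + hx g * hy h).
Proof. by []. Qed.

Section Renormalization.
Context {R : realType}.
Variables (al be ga : R).
Implicit Types (g h : heis R) (s t : R).

(** The one-parameter subgroup whose tangent vector at the identity is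
    [(al, be, ga)]; the quadratic term is the passage from exponential
    coordinates to matrix entries. *)
Definition flow t : heis R := Heis (t * al) (t * be) (t * ga + t ^+ 2 * (al * be) / 2).

Lemma flowD s t : flow (s + t) = (flow s * flow t)%g.
Proof.
rewrite heis_mulE /flow /Heis /hx /hy /hz/=.
by congr (_, _, _); field.
Qed.

Lemma flow0 : flow 0 = 1%g.
Proof.
rewrite -[RHS]/(Heis 0 0 0) /flow.
by congr (_, _, _); rewrite ?mul0r ?expr0n ?mul0r ?addr0.
Qed.

(** An automorphism of the Heisenberg group, with inverse [N'], that preserves
    the integer subgroup and stretches the flow by the factor [lam]. *)
Record renormalization (N N' : heis R -> heis R) (lam : R) : Prop := Renormalization {
  renormM : forall g h, N (g * h)%g = (N g * N h)%g;
  renormK : cancel N N';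
  renormVK : cancel N' N;
  renorm_int : forall g, g \in heis_int R -> N g \in heis_int R;
  renormV_int : forall g, g \in heis_int R -> N' g \in heis_int R;
  renorm_flow : forall t, N (flow t) = flow (lam * t);
  renorm_meas : measurable_fun setT (N : R * R * R -> R * R * R);
  renormV_meas : measurable_fun setT (N' : R * R * R -> R * R * R) }.

Lemma renormalization_comp N N' lam P P' mu :
  renormalization N N' lam -> renormalization P P' mu ->
  renormalization (N \o P) (P' \o N') (lam * mu).
Proof.
move=> n p; split => [g h|||g gZ|g gZ|t||].
- by rewrite /= (renormM p) (renormM n).
- by move=> g /=; rewrite (renormK n) (renormK p).
- by move=> g /=; rewrite (renormVK p) (renormVK n).
- exact/(renorm_int n)/(renorm_int p).
- exact/(renormV_int p)/(renormV_int n).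
- by rewrite /= (renorm_flow p) (renorm_flow n) mulrA.
- exact: measurableT_comp (renorm_meas n) (renorm_meas p).
- exact: measurableT_comp (renormV_meas p) (renormV_meas n).
Qed.

Lemma renormalization_iter N N' lam k : renormalization N N' lam ->
  exists P P', renormalization P P' (lam ^+ k).
Proof.
move=> n; elim: k => [|k [P [P' p]]].
  exists id, id; split => //; try exact: measurable_id.
  by move=> t; rewrite expr0 mul1r.
by exists (N \o P), (P' \o N'); rewrite exprS; exact: renormalization_comp.
Qed.

(** Even powers are taken so that the factor is positive, whatever the sign of
    [lam]: the flow then keeps its direction. *)
Lemma renormalization_large N N' lam : renormalization N N' lam -> 1 < `|lam| ->
  exists P P' L, 2 <= L /\ renormalization P P' L.
Proof.
move=> n lam1; pose d := `|lam| ^+ 2 - 1.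
have d0 : 0 < d by rewrite subr_gt0 exprn_egt1.
pose k := Num.truncn d^-1.
have [P [P' p]] := renormalization_iter (2 * k.+1) n.
exists P, P', (lam ^+ (2 * k.+1)); split => //.
rewrite exprM -real_normK ?num_real// (_ : `|lam| ^+ 2 = 1 + d); last by rewrite /d; ring.
apply: le_trans (bernoulli_ge _ _); last by lra.
(* By Bernoulli it is enough that [1 <= k.+1 * d]. *)
rewrite -[2]/(1 + 1) lerD2l -ler_pdivrMr// div1r ltW//.
exact: truncnS_gt.
Qed.

End Renormalization.

Section AffineAutomorphism.
Context {R : realType}.
Variables (A B C D n m : R).
Hypothesis detE : (A * D - B * C) ^+ 2 = 1.
Local Notation e := (A * D - B * C).
Implicit Types g h : heis R.

(** In exponential coordinates, where the central coordinate [z] is replaced by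
    [z - x * y / 2], this is the linear map with block [A, B, C, D], central
    factor [e] and the linear form [(n - A * C / 2, m - B * D / 2)]. *)
Definition aut_form (x y : R) := n * x + m * y +
  A * C * (x * (x - 1) / 2) + B * D * (y * (y - 1) / 2) + B * C * (x * y).

Definition aut g : heis R :=
  Heis (A * hx g + B * hy g) (C * hx g + D * hy g) (e * hz g + aut_form (hx g) (hy g)).

Definition autV g : heis R :=
  let x := e * (D * hx g - B * hy g) in
  let y := e * (A * hy g - C * hx g) in
  Heis x y (e * (hz g - aut_form x y)).

Lemma autM g h : aut (g * h)%g = (aut g * aut h)%g.
Proof.
case: g => -[a b] c; case: h => -[a' b'] c'.
rewrite !heis_mulE /aut /Heis /hx /hy /hz/= /aut_form.
by congr (_, _, _); field.
Qed.

Lemma autK : cancel aut autV.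
Proof.
case=> -[a b] c; rewrite /autV /aut /Heis /hx /hy /hz/=.
have -> : e * (D * (A * a + B * b) - B * (C * a + D * b)) = e ^+ 2 * a by ring.
have -> : e * (A * (C * a + D * b) - C * (A * a + B * b)) = e ^+ 2 * b by ring.
by rewrite detE !mul1r addrK mulrA -expr2 detE mul1r.
Qed.

Lemma autVK : cancel autV aut.
Proof.
case=> -[a b] c; rewrite /autV /aut /Heis /hx /hy /hz/=.
set x := e * _; set y := e * _.
have -> : A * x + B * y = e ^+ 2 * a by rewrite /x /y; ring.
have -> : C * x + D * y = e ^+ 2 * b by rewrite /x /y; ring.
by rewrite mulrA -expr2 detE !mul1r subrK.
Qed.

Hypothesis intE : [/\ A \is a Num.int, B \is a Num.int, C \is a Num.int, D \is a Num.int &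
  n \is a Num.int /\ m \is a Num.int].

Lemma aut_form_int x y : x \is a Num.int -> y \is a Num.int -> aut_form x y \is a Num.int.
Proof.
have [AZ BZ CZ DZ [nZ mZ]] := intE => xZ yZ.
have [] := (int_bin2 xZ, int_bin2 yZ); rewrite /aut_form.
move: (x * (x - 1) / 2) (y * (y - 1) / 2) => p q pZ qZ.
by do ![exact: rpredD | apply: rpredD | apply: rpredM].
Qed.

Lemma aut_int g : g \in heis_int R -> aut g \in heis_int R.
Proof.
have [AZ BZ CZ DZ _] := intE.
rewrite !inE => /and3P[xZ yZ zZ].
rewrite -[hx (aut g)]/(A * hx g + B * hy g) -[hy (aut g)]/(C * hx g + D * hy g).
rewrite -[hz (aut g)]/(e * hz g + aut_form (hx g) (hy g)).
have fZ := aut_form_int xZ yZ.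
have eZ : e \is a Num.int by apply: rpredB; exact: rpredM.
by apply/and3P; split; apply: rpredD => //; apply: rpredM.
Qed.

Lemma autV_int g : g \in heis_int R -> autV g \in heis_int R.
Proof.
have [AZ BZ CZ DZ _] := intE.
rewrite !inE => /and3P[xZ yZ zZ].
pose x := e * (D * hx g - B * hy g); pose y := e * (A * hy g - C * hx g).
rewrite -[hx (autV g)]/x -[hy (autV g)]/y -[hz (autV g)]/(e * (hz g - aut_form x y)).
have eZ : e \is a Num.int by apply: rpredB; exact: rpredM.
have xZ' : x \is a Num.int by apply: rpredM => //; apply: rpredB; exact: rpredM.
have yZ' : y \is a Num.int by apply: rpredM => //; apply: rpredB; exact: rpredM.
rewrite xZ' yZ'/=; apply: rpredM => //; apply: rpredB => //; exact: aut_form_int.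
Qed.

(** The third hypothesis is the equation of an eigenvector, for the central
    coordinate, of the linear map described at [aut_form]: it is what fixes the
    value of [ga]. *)
Lemma aut_flow al be ga lam : A * al + B * be = lam * al -> C * al + D * be = lam * be ->
  (lam - e) * ga = al * (n - A * C / 2) + be * (m - B * D / 2) ->
  forall t, aut (flow al be ga t) = flow al be ga (lam * t).
Proof.
move=> h1 h2 h3 t; rewrite /aut /flow /Heis /hx /hy /hz/=.
have E1 : A * (t * al) + B * (t * be) = lam * t * al.
  by rewrite (mulrC lam) -mulrA -h1; ring.
have E2 : C * (t * al) + D * (t * be) = lam * t * be.
  by rewrite (mulrC lam) -mulrA -h2; ring.
congr (_, _, _) => //.
have -> : (lam * t) ^+ 2 * (al * be) / 2 = (lam * t * al) * (lam * t * be) / 2 by field.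
have -> : lam * t * ga = t * (e * ga + (lam - e) * ga) by ring.
by rewrite -E1 -E2 h3 /aut_form; field.
Qed.

Lemma aut_form_meas d (T : measurableType d) (f g : T -> R) :
  measurable_fun setT f -> measurable_fun setT g ->
  measurable_fun setT (fun t => aut_form (f t) (g t)).
Proof.
move=> mf mg; rewrite /aut_form.
have mq (h : T -> R) : measurable_fun setT h -> measurable_fun setT (fun t => h t * (h t - 1) / 2).
  move=> mh; apply: measurable_funM => //; apply: measurable_funM => //.
  exact: measurable_funB.
repeat (apply: measurable_funD); apply: measurable_funM => //; try exact: mq.
exact: measurable_funM.
Qed.

Lemma aut_meas : measurable_fun setT (aut : R * R * R -> R * R * R).
Proof.
have m1 : measurable_fun setT (@hx R : R * R * R -> R).
  exact: (measurableT_comp measurable_fst measurable_fst).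
have m2 : measurable_fun setT (@hy R : R * R * R -> R).
  exact: (measurableT_comp measurable_snd measurable_fst).
have m3 : measurable_fun setT (@hz R : R * R * R -> R) by exact: measurable_snd.
apply: measurable_fun_pair; last first.
  apply: measurable_funD; first exact: measurable_funM.
  exact: aut_form_meas.
by apply: measurable_fun_pair; apply: measurable_funD; apply: measurable_funM.
Qed.

Lemma autV_meas : measurable_fun setT (autV : R * R * R -> R * R * R).
Proof.
have m1 : measurable_fun setT (@hx R : R * R * R -> R).
  exact: (measurableT_comp measurable_fst measurable_fst).
have m2 : measurable_fun setT (@hy R : R * R * R -> R).
  exact: (measurableT_comp measurable_snd measurable_fst).
have m3 : measurable_fun setT (@hz R : R * R * R -> R) by exact: measurable_snd.
have mx : measurable_fun setT (fun g : R * R * R => e * (D * hx g - B * hy g)).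
  by apply: measurable_funM => //; apply: measurable_funB; exact: measurable_funM.
have my : measurable_fun setT (fun g : R * R * R => e * (A * hy g - C * hx g)).
  by apply: measurable_funM => //; apply: measurable_funB; exact: measurable_funM.
apply: measurable_fun_pair; first exact: measurable_fun_pair.
apply: measurable_funM => //; apply: measurable_funB => //.
exact: aut_form_meas.
Qed.

Lemma aut_renormalization al be ga lam :
  A * al + B * be = lam * al -> C * al + D * be = lam * be ->
  (lam - e) * ga = al * (n - A * C / 2) + be * (m - B * D / 2) ->
  renormalization al be ga aut autV lam.
Proof.
move=> h1 h2 h3; split.
- exact: autM.
- exact: autK.
- exact: autVK.
- exact: aut_int.
- exact: autV_int.
- exact: aut_flow.
- exact: aut_meas.
- exact: autV_meas.
Qed.

End AffineAutomorphism.

(** * Crossing the section along the renormalized flow *)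
Section ChartCoordinates.
Context {R : realType} {Y : ptopologicalType}.
Variables (X W : Y -> R) (F : R * R -> Y).
Hypothesis chart : torus_chart X W F.

Lemma chart_map_measurable (T : Y -> Y) (P : R * R -> R * R) :
  measurable_fun setT P -> (forall x w, T (F (x, w)) = F (P (x, w))) ->
  measurable_fun setT (T : borel Y -> borel Y).
Proof.
move=> mP TF; rewrite (_ : T = F \o (P \o (fun y => (X y, W y)))).
  apply: measurableT_comp; first exact: chart_measurable chart.
  by apply: measurableT_comp => //; exact: (chart_coord_measurable chart).
by apply/funext => y /=; rewrite -TF (chart_K chart).
Qed.

End ChartCoordinates.

Section HeisMeasurability.
Context {R : realType} {d : measure_display} {S : measurableType d}.
Implicit Types f g : S -> R * R * R.

Lemma measurable_hx f : measurable_fun setT f -> measurable_fun setT (fun s => hx (f s)).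
Proof.
move=> mf; apply: (measurableT_comp measurable_fst).
exact: (measurableT_comp measurable_fst).
Qed.

Lemma measurable_hy f : measurable_fun setT f -> measurable_fun setT (fun s => hy (f s)).
Proof.
move=> mf; apply: (measurableT_comp measurable_snd).
exact: (measurableT_comp measurable_fst).
Qed.

Lemma measurable_hz f : measurable_fun setT f -> measurable_fun setT (fun s => hz (f s)).
Proof. by move=> mf; exact: (measurableT_comp measurable_snd). Qed.

Lemma measurable_hw f : measurable_fun setT f -> measurable_fun setT (fun s => hw (f s)).
Proof.
move=> mf; have mx := measurable_hx mf; have my := measurable_hy mf.
have mz := measurable_hz mf; rewrite /hw.
apply: measurable_funD.
  apply: measurable_funB => //; apply: measurable_funM => //.
  exact: measurable_funD.
by do ?apply: measurable_funM => //; exact: measurable_funB.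
Qed.

Lemma measurable_heisM f g : measurable_fun setT f -> measurable_fun setT g ->
  measurable_fun setT (fun s => ((f s : heis R) * g s)%g : R * R * R).
Proof.
move=> mf mg.
have [fx gx] := (measurable_hx mf, measurable_hx mg).
have [fy gy] := (measurable_hy mf, measurable_hy mg).
have [fz gz] := (measurable_hz mf, measurable_hz mg).
apply: measurable_fun_pair; first by apply: measurable_fun_pair; exact: measurable_funD.
by do ?apply: measurable_funD => //; exact: measurable_funM.
Qed.

Lemma measurable_flow al be ga (t : S -> R) : measurable_fun setT t ->
  measurable_fun setT (fun s => flow al be ga (t s) : R * R * R).
Proof.
move=> mt; apply: measurable_fun_pair.
  by apply: measurable_fun_pair; exact: measurable_funM.
apply: measurable_funD; first exact: measurable_funM.
by do ?apply: measurable_funM => //; exact: measurable_funX.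
Qed.

End HeisMeasurability.

Section Transversal.
Context {R : realType}.
Variables (al be ga : R).
Hypothesis al_be : al + be = 1.
Local Notation flow := (flow al be ga).
Implicit Types (g h w : heis R) (x y : slice R) (t : R).

Definition height g := hx g + hy g.

Lemma heightM g h : height (g * h)%g = height g + height h.
Proof. by rewrite heis_mulE /height /hx /hy/=; ring. Qed.

Lemma height_flow t : height (flow t) = t.
Proof. by rewrite /height /hx /hy/= -mulrDr al_be mulr1. Qed.

Lemma height_int w : w \in heis_int R -> height w \is a Num.int.
Proof. by rewrite inE => /and3P[xZ yZ _]; exact: rpredD. Qed.

(** The point at time [t] on the flow line of [g], as a point of the subgroup
    [x + y] integer; this is meant for the times [t] that reach it. *)
Definition slice_at t g : slice R := insubd (1%g : slice R) (flow t * g)%g.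

Lemma val_slice_at t g : t + height g \is a Num.int ->
  val (slice_at t g) = (flow t * g)%g.
Proof.
move=> tg; rewrite val_insubd inE -/(height (flow t * g)%g) heightM height_flow.
by rewrite tg.
Qed.

Lemma pi_eqM x y w : w \in heis_int R -> val y = (val x * w)%g ->
  \pi_(nilmanifold R) y = \pi_(nilmanifold R) x.
Proof.
by move=> wZ yE; apply/esym/eqmodP/coset_eqP; exists w.
Qed.

Lemma repr_piM x : exists2 w, w \in heis_int R &
  val x = (val (repr (\pi_(nilmanifold R) x)) * w)%g.
Proof. by apply/coset_eqP/eqmodP; rewrite reprK. Qed.

(** The first point of the section at or after [g] on its flow line. *)
Definition above g := slice_at ((Num.ceil (height g))%:~R - height g) g.
(** The last point of the section at or before [g] on its flow line. *)
Definition below g := slice_at (- fract (height g)) g.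

Lemma val_above g : val (above g) = (flow ((Num.ceil (height g))%:~R - height g) * g)%g.
Proof. by rewrite val_slice_at// subrK intr_int. Qed.

Lemma val_below g : val (below g) = (flow (- fract (height g)) * g)%g.
Proof. by rewrite val_slice_at// addrC -opprB rpredN fractB_int. Qed.

Lemma fractDint t k : k \is a Num.int -> fract (t + k) = fract t.
Proof.
move=> kZ; apply: fract_uniq; first exact: fract_itv.
by rewrite opprD addrA rpredB// fractB_int.
Qed.

Lemma pi_above g w : w \in heis_int R ->
  \pi_(nilmanifold R) (above (g * w)%g) = \pi_(nilmanifold R) (above g).
Proof.
move=> wZ; apply: (pi_eqM wZ); rewrite !val_above -mulgA; congr (flow _ * _)%g.
rewrite heightM; have /intrP[k ->] := height_int wZ.
by rewrite ceilDrz ?intr_int// intrD intrKceil; ring.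
Qed.

Lemma pi_below g w : w \in heis_int R ->
  \pi_(nilmanifold R) (below (g * w)%g) = \pi_(nilmanifold R) (below g).
Proof.
move=> wZ; apply: (pi_eqM wZ); rewrite !val_below -mulgA; congr (flow _ * _)%g.
by rewrite heightM fractDint// height_int.
Qed.

Section Renorm.
Variables (N N' : heis R -> heis R) (L : R).
Hypothesis ren : renormalization al be ga N N' L.
Hypothesis L2 : 2 <= L.

Let L0 : 0 < L. Proof. by apply: lt_le_trans L2. Qed.

Lemma renormVM g h : N' (g * h)%g = (N' g * N' h)%g.
Proof.
by rewrite -[g in LHS](renormVK ren) -[h in LHS](renormVK ren) -(renormM ren) (renormK ren).
Qed.

Lemma renormV_flow t : N' (flow t) = flow (t / L).
Proof.
rewrite -[RHS](renormK ren) (renorm_flow ren); congr (N' (flow _)).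
by rewrite mulrCA mulfV ?mulr1// gt_eqF.
Qed.

Definition expand (q : nilmanifold R) : nilmanifold R :=
  \pi_(nilmanifold R) (above (N (val (repr q)))).

Definition contract (q : nilmanifold R) : nilmanifold R :=
  \pi_(nilmanifold R) (below (N' (val (repr q)))).

(** The image of [expand].  A point of it is at a time less than 1 after a point
    of the image of the section by [N]; applying [N'] divides this time by [L]. *)
Definition induced_set : set (nilmanifold R) :=
  [set q | fract (height (N' (val (repr q)))) < L^-1].

Lemma expand_pi x : expand (\pi_(nilmanifold R) x) = \pi_(nilmanifold R) (above (N (val x))).
Proof.
have [w wZ ->] := repr_piM x.
by rewrite (renormM ren) pi_above//; exact: renorm_int ren _ wZ.
Qed.

Lemma contract_pi x : contract (\pi_(nilmanifold R) x) = \pi_(nilmanifold R) (below (N' (val x))).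
Proof.
have [w wZ ->] := repr_piM x.
by rewrite renormVM pi_below//; exact: renormV_int ren _ wZ.
Qed.

Lemma induced_set_pi x : induced_set (\pi_(nilmanifold R) x) =
  (fract (height (N' (val x))) < L^-1) :> Prop.
Proof.
have [w wZ ->] := repr_piM x; rewrite /induced_set/= renormVM heightM fractDint//.
exact/height_int/(renormV_int ren).
Qed.

Let slice_height x : height (val x) \is a Num.int.
Proof. exact: slice_int. Qed.

Let fract_small t k : k \is a Num.int -> 0 <= t < 1 -> fract (t + k) = t.
Proof. by move=> kZ t01; rewrite fractDint//; apply: fract_uniq; rewrite ?subrr ?rpred0. Qed.

Let N'flowN t g : N' (flow t * N g)%g = (flow (t / L) * g)%g.
Proof. by rewrite renormVM renormV_flow (renormK ren). Qed.

Let ceilB t : 0 <= (Num.ceil t)%:~R - t < 1.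
Proof. by have := ceil_itv t; rewrite intrB => /andP[? ?]; apply/andP; split; lra. Qed.

Let divL01 t : 0 <= t < 1 -> 0 <= t / L < 1.
Proof.
move=> /andP[t0 t1]; rewrite divr_ge0 ?(ltW L0)//= ltr_pdivrMr// mul1r.
by rewrite (lt_le_trans t1)// (le_trans _ L2)// ler1n.
Qed.

Lemma induced_set_expand q : induced_set (expand q).
Proof.
rewrite -(reprK q) expand_pi induced_set_pi val_above N'flowN heightM height_flow.
set v := _ - height _; have v01 : 0 <= v < 1 by exact: ceilB.
rewrite fract_small ?divL01// -[ltRHS]mul1r ltr_pM2r ?invr_gt0//.
by case/andP : v01.
Qed.

Lemma expandK : cancel expand contract.
Proof.
move=> q; rewrite -(reprK q) expand_pi contract_pi; congr (\pi _); apply: val_inj.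
rewrite val_below val_above N'flowN heightM height_flow.
set v := _ - height _; have v01 : 0 <= v < 1 by exact: ceilB.
by rewrite fract_small ?divL01// mulgA -flowD addNr flow0 mul1g.
Qed.

Lemma contractK q : induced_set q -> expand (contract q) = q.
Proof.
rewrite -{1}(reprK q) induced_set_pi => Aq.
rewrite -[in LHS](reprK q) contract_pi expand_pi -[RHS]reprK; congr (\pi _); apply: val_inj.
rewrite val_above val_below; set x := val (repr q) in Aq *.
rewrite (renormM ren) (renormVK ren) (renorm_flow ren) heightM height_flow.
set r := fract _ in Aq *; have r01 := fract_itv (height (N' x)); rewrite -/r in r01.
have Lr : 0 <= L * r < 1.
  case/andP : r01 => r0 _; rewrite mulr_ge0 ?(ltW L0)//= -ltr_pdivlMl// mulr1//.
have /intrP[k hk] : height x \is a Num.int by exact: slice_height.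
(* The next section above height [k - L * r] is the one of [x], at height [k]. *)
have -> : Num.ceil (L * - r + height x) = k.
  by apply: ceil_def; rewrite hk intrB; lra.
by rewrite mulgA -flowD hk (_ : k%:~R - (L * - r + k%:~R) + L * - r = 0) ?flow0 ?mul1g//; ring.
Qed.

Lemma iter_niltranslation (g0 : slice R) n x : val g0 = flow 1 ->
  exists2 y, iter n (niltranslation g0) (\pi_(nilmanifold R) x) = \pi_(nilmanifold R) y &
             val y = (flow n%:R * val x)%g.
Proof.
move=> g0E; elim: n => [|n [y yE vy]]; first by exists x => //; rewrite flow0 mul1g.
exists (g0 * y)%g; first by rewrite iterS yE niltranslationE.
rewrite -[LHS]/(val g0 * val y)%g g0E vy mulgA -flowD.
by rewrite -natr1 addrC.
Qed.

(** The points [expand q] and [expand (T q)] come from the points [N x] and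
    [flow L * N x] of a flow line, at the heights [v] and [v + L]; the number
    of steps from one to the other is [ceil (v + L) - ceil v].  At an intermediate
    section, the time elapsed since [N x] is at least 1 and less than [L], so
    the point is outside [induced_set]. *)
Lemma return_expand (g0 : slice R) q : val g0 = flow 1 ->
  exists2 n, @is_return_time _ (borel (nilmanifold R)) (niltranslation g0)
               induced_set (expand q) n &
    iter n (niltranslation g0) (expand q) = expand (niltranslation g0 q).
Proof.
move=> g0E; rewrite -(reprK q); move: (repr q) => x {q}.
set v := height (N (val x)).
pose tau : R := (Num.ceil v)%:~R - v.
have tau01 : 0 <= tau < 1 by exact: ceilB.
have tau'01 := ceilB (v + L).
have [n nE] : exists n : nat, n%:R = (Num.ceil (v + L))%:~R - (Num.ceil v)%:~R :> R.
  have : (0 <= Num.ceil (v + L) - Num.ceil v)%R.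
    by rewrite subr_ge0 le_ceil// lerDl ltW.
  case: (Num.ceil (v + L) - Num.ceil v) (intrB R (Num.ceil (v + L)) (Num.ceil v)) => // n <- _.
  by exists n.
have itE k : exists2 y, iter k (niltranslation g0) (expand (\pi x)) = \pi_(nilmanifold R) y &
    val y = (flow (k%:R + tau) * N (val x))%g.
  rewrite expand_pi; have [y yE vy] := iter_niltranslation k (above (N (val x))) g0E.
  by exists y => //; rewrite vy val_above mulgA -flowD.
have n_tau : n%:R + tau = L + ((Num.ceil (v + L))%:~R - (v + L)).
  by rewrite nE /tau; ring.
have nT : iter n (niltranslation g0) (expand (\pi x)) = expand (niltranslation g0 (\pi x)).
  have [y -> vy] := itE n; rewrite niltranslationE expand_pi; congr (\pi _); apply: val_inj.
  rewrite vy val_above -[val (g0 * x)%g]/(val g0 * val x)%g g0E.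
  rewrite (renormM ren) (renorm_flow ren) mulr1 mulgA -flowD heightM height_flow -/v.
  by rewrite n_tau addrC (addrC L v).
have n0 (a b c l : R) : a + b = l + c -> 0 <= b < 1 -> 0 <= c < 1 -> 2 <= l -> 0 < a.
  by move=> abc /andP[? ?] /andP[? ?] ?; lra.
exists n => //; split.
- rewrite -(ltr0n R); exact: n0 n_tau tau01 tau'01 L2.
- by rewrite nT; exact: induced_set_expand.
- move=> k /andP[k0 kn]; have [y -> vy] := itE k.
  rewrite induced_set_pi vy N'flowN heightM height_flow.
  have k1 : (k%:R + 1 : R) <= n%:R by rewrite natr1 ler_nat.
  have k0' : 1 <= k%:R :> R by rewrite ler1n.
  have /andP[? ?] := tau01; have /andP[? ?] := tau'01.
  rewrite fract_small//; last first.
    by rewrite divr_ge0 ?(ltW L0)//= ?ltr_pdivrMr ?mul1r//; lra.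
  by apply/negP; rewrite -leNgt -[leLHS]mul1r ler_pM2r ?invr_gt0//; lra.
Qed.


Let lift (p : R * R) : heis R := val (slice_pt p).

Let measurable_lift : measurable_fun setT (lift : R * R -> R * R * R).
Proof.
have m1 : measurable_fun setT (fun p : R * R => p.1) := measurable_fst.
have m2 : measurable_fun setT (fun p : R * R => p.2) := measurable_snd.
apply: measurable_fun_pair; first by apply: measurable_fun_pair => //; exact: measurableT_comp.
apply: measurable_funB => //; do ?apply: measurable_funM => //.
exact: measurable_funB.
Qed.

Let measurable_height d (S : measurableType d) (f : S -> R * R * R) :
  measurable_fun setT f -> measurable_fun setT (fun s => height (f s)).
Proof.
by move=> mf; apply: measurable_funD; [exact: measurable_hx|exact: measurable_hy].
Qed.

Let measurable_xw d (S : measurableType d) (f : S -> R * R * R) :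
  measurable_fun setT f -> measurable_fun setT (fun s => (hx (f s), hw (f s))).
Proof.
by move=> mf; apply: measurable_fun_pair; [exact: measurable_hx|exact: measurable_hw].
Qed.

Lemma expand_measurable :
  measurable_fun setT (expand : borel (nilmanifold R) -> borel (nilmanifold R)).
Proof.
have mN : measurable_fun setT ((fun p => N (lift p)) : R * R -> R * R * R).
  exact: measurableT_comp (renorm_meas ren) measurable_lift.
pose P p := (flow ((Num.ceil (height (N (lift p))))%:~R - height (N (lift p))) * N (lift p))%g.
apply: (chart_map_measurable nil_chart (P := fun p => (hx (P p), hw (P p)))).
  apply: measurable_xw; apply: measurable_heisM => //; apply: measurable_flow.
  apply: measurable_funB; last exact: measurable_height.
  have mc : measurable_fun setT (fun t : R => (Num.ceil t)%:~R : R).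
    by apply: nondecreasing_measurable => // t t' tt'; rewrite ler_int le_ceil.
  by apply: (measurableT_comp mc); exact: measurable_height.
by move=> x w; rewrite expand_pi pi_nilF val_above.
Qed.

Lemma contract_measurable :
  measurable_fun setT (contract : borel (nilmanifold R) -> borel (nilmanifold R)).
Proof.
have mN : measurable_fun setT ((fun p => N' (lift p)) : R * R -> R * R * R).
  exact: measurableT_comp (renormV_meas ren) measurable_lift.
pose P p := (flow (- fract (height (N' (lift p)))) * N' (lift p))%g.
apply: (chart_map_measurable nil_chart (P := fun p => (hx (P p), hw (P p)))).
  apply: measurable_xw; apply: measurable_heisM => //; apply: measurable_flow.
  apply: measurableT_comp => //.
  by apply: (measurableT_comp measurable_fract); exact: measurable_height.
by move=> x w; rewrite contract_pi pi_nilF val_below.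
Qed.

Lemma induced_set_measurable : measurable (induced_set : set (borel (nilmanifold R))).
Proof.
have mN : measurable_fun setT ((fun p => N' (lift p)) : R * R -> R * R * R).
  exact: measurableT_comp (renormV_meas ren) measurable_lift.
have mf : measurable_fun setT (fun q : borel (nilmanifold R) =>
    fract (height (N' (lift (nilX q, nilW q))))).
  apply: (measurableT_comp measurable_fract).
  apply: (measurableT_comp (measurable_height mN)).
  exact: (chart_coord_measurable nil_chart).
have := mf measurableT `]-oo, L^-1[%classic (measurable_itv _); rewrite setTI.
congr measurable; apply/seteqP; split => q /=;
  by rewrite in_itv/= -[q in induced_set q](chart_K nil_chart) induced_set_pi.
Qed.

Variable g0 : slice R.
Hypothesis g0E : val g0 = flow 1.

Lemma induced_set_covers q : exists n, induced_set (iter n (niltranslation g0) q).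
Proof.
set r := fract (height (N' (val (repr q)))).
pose n := `|Num.ceil (L * (1 - r))|%N.
have /andP[r0 r1] := fract_itv (height (N' (val (repr q)))); rewrite -/r in r0 r1.
have nE : n%:R = (Num.ceil (L * (1 - r)))%:~R :> R.
  rewrite /n pmulrn gez0_abs// ceil_ge0 (lt_le_trans (ltrN10 R))//.
  by rewrite mulr_ge0 ?subr_ge0 ?ltW.
have := ceil_itv (L * (1 - r)); rewrite intrB -nE => /andP[n1 n2].
exists n; have [y yE vy] := iter_niltranslation n (repr q) g0E.
rewrite reprK in yE; rewrite yE induced_set_pi.
rewrite vy renormVM heightM renormV_flow height_flow addrC.
have nL1 : 1 - r <= n%:R / L by rewrite ler_pdivlMr// mulrC.
have nL2 : n%:R / L < 1 - r + L^-1.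
  by rewrite ltr_pdivrMr// mulrDl mulVf ?gt_eqF// (mulrC _ L); lra.
rewrite (@fract_uniq _ _ (r + n%:R / L - 1)); first by lra.
  have : L^-1 <= 1 by rewrite invf_le1// (le_trans _ L2)// ler1n.
  by move=> ?; apply/andP; split; lra.
rewrite (_ : _ - _ = r - height (N' (val (repr q))) - 1); last by ring.
by apply: rpredB; [exact: fractB_int|exact: rpred1].
Qed.

(** One step of the niltranslation moves the height after [N'] by [1 / L],
    out of the interval from 0 to [1 / L] as [2 <= L]. *)
Lemma induced_set_disjoint : induced_set `&` niltranslation g0 @^-1` induced_set = set0.
Proof.
apply/seteqP; split => // q [Aq Tq].
have [y yE vy] := iter_niltranslation 1 (repr q) g0E.
rewrite reprK /= in yE; rewrite /= yE induced_set_pi in Tq.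
rewrite -(reprK q) induced_set_pi in Aq.
move: Tq; rewrite vy renormVM heightM renormV_flow height_flow addrC => {yE vy y}.
set r := fract _ in Aq; have /andP[r0 r1] := fract_itv (height (N' (val (repr q)))).
rewrite -/r in r0 r1.
have LV : L^-1 <= 2^-1 by rewrite lef_pV2 ?posrE.
have LV0 : 0 < L^-1 by rewrite invr_gt0.
rewrite (@fract_uniq _ _ (r + L^-1)); first by move=> h; exfalso; lra.
  by apply/andP; split; lra.
by rewrite mul1r (_ : _ - _ = r - height (N' (val (repr q)))); [exact: fractB_int|ring].
Qed.

End Renorm.

End Transversal.

(** * The niltranslation *)
Section HaarMeasure.
Context {R : realType}.

Lemma niltranslation_measurable (g : slice R) :
  measurable_fun setT (niltranslation g : borel (nilmanifold R) -> borel (nilmanifold R)).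
Proof.
set k := hx (val g) + hy (val g).
set c := hz (val g) - k * hx (val g) + hx (val g) * (hx (val g) - 1) / 2.
apply: (chart_map_measurable nil_chart (P := fun p => (p.1 + hx (val g), p.2 - k * p.1 + c)));
  last by move=> x w; exact: niltranslation_nilF.
have m1 : measurable_fun setT (fun p : R * R => p.1) := measurable_fst.
have m2 : measurable_fun setT (fun p : R * R => p.2) := measurable_snd.
apply: measurable_fun_pair; first exact: measurable_funD.
by apply: measurable_funD => //; apply: measurable_funB => //; exact: measurable_funM.
Qed.

Lemma niltranslationK (g : slice R) : cancel (niltranslation g) (niltranslation g^-1%g).
Proof. by move=> q; rewrite -(reprK q) !niltranslationE mulKg !reprK. Qed.

Lemma niltranslationVK (g : slice R) : cancel (niltranslation g^-1%g) (niltranslation g).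
Proof. by move=> q; rewrite -(reprK q) !niltranslationE mulVKg !reprK. Qed.

Lemma exists_haar : exists2 mu : probability (borel (nilmanifold R)) R,
  haar mu & forall B, mu B = torus_measure (@nilF R @^-1` B).
Proof.
have [mu muE] := image_probability (@torus_measure R) (chart_measurable (@nil_chart R)).
exists mu => // g; set k := hx (val g) + hy (val g).
set c := hz (val g) - k * hx (val g) + hx (val g) * (hx (val g) - 1) / 2.
apply: (chart_measure_preserving (@nil_chart R) muE
  (a := hx (val g)) (s := fun x => - (k * x) + c)).
- exact: niltranslation_measurable.
- by apply: measurable_funD => //; apply: measurableT_comp => //; exact: measurable_funM.
- by move=> x w; rewrite niltranslation_nilF; congr (nilF (_, _)); rewrite -addrA.
Qed.

End HaarMeasure.

Section Irrationality.
Context {R : realType}.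

(** If [j * al] is an integer then so is [j * be], and the inverse of the
    matrix, which is integral, maps the integer vector [(j * al, j * be)] to
    [lam^-1] times itself.  So the sum of the coordinates of the n-th image,
    [lam ^- n * j], is a nonzero integer that tends to 0. *)
Lemma eigen_irrational (A B C D lam al be : R) :
  A \is a Num.int -> B \is a Num.int -> C \is a Num.int -> D \is a Num.int ->
  (A * D - B * C) ^+ 2 = 1 -> 1 < `|lam| -> al + be = 1 ->
  A * al + B * be = lam * al -> C * al + D * be = lam * be ->
  forall j : int, j != 0 -> j%:~R * al \isn't a Num.int.
Proof.
move=> AZ BZ CZ DZ e2 lam1 ab h1 h2 j j0; apply/negP => jal.
set e := _ - _ in e2; have eZ : e \is a Num.int by apply: rpredB; exact: rpredM.
have lam0 : lam != 0 by rewrite -normr_gt0 (lt_trans ltr01).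
have k1 x y : A * x + B * y = lam * x -> C * x + D * y = lam * y ->
  lam^-1 * x = e * (D * x - B * y).
  move=> hx hy; apply: (mulfI lam0); rewrite mulVKf// mulrCA.
  rewrite mulrBr (mulrCA lam D) (mulrCA lam B) -hx -hy.
  by rewrite -[LHS]mul1r -e2 /e; ring.
have k2 x y : A * x + B * y = lam * x -> C * x + D * y = lam * y ->
  lam^-1 * y = e * (A * y - C * x).
  move=> hx hy; apply: (mulfI lam0); rewrite mulVKf// mulrCA.
  rewrite mulrBr (mulrCA lam A) (mulrCA lam C) -hx -hy.
  by rewrite -[LHS]mul1r -e2 /e; ring.
have key n : lam ^- n * (j%:~R * al) \is a Num.int /\ lam ^- n * (j%:~R * be) \is a Num.int.
  elim: n => [|n [xZ yZ]].
    rewrite expr0 invr1 !mul1r; split => //.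
    by rewrite (_ : be = 1 - al) ?mulrBr ?mulr1 ?rpredB ?intr_int// -ab addrC addKr.
  have hx : A * (lam ^- n * (j%:~R * al)) + B * (lam ^- n * (j%:~R * be)) =
            lam * (lam ^- n * (j%:~R * al)).
    rewrite (_ : lam * _ = lam ^- n * j%:~R * (lam * al)); last by ring.
    by rewrite -h1; ring.
  have hy : C * (lam ^- n * (j%:~R * al)) + D * (lam ^- n * (j%:~R * be)) =
            lam * (lam ^- n * (j%:~R * be)).
    rewrite (_ : lam * _ = lam ^- n * j%:~R * (lam * be)); last by ring.
    by rewrite -h2; ring.
  rewrite exprS invfM -!mulrA (k1 _ _ hx hy) (k2 _ _ hx hy).
  by split; apply: rpredM => //; apply: rpredB; exact: rpredM.
have jn n : lam ^- n * j%:~R \is a Num.int.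
  have [xZ yZ] := key n.
  rewrite (_ : _ * _ = lam ^- n * (j%:~R * al) + lam ^- n * (j%:~R * be)); first exact: rpredD.
  by rewrite -!mulrDr ab mulr1.
pose d := `|lam| - 1; have d0 : 0 < d by rewrite subr_gt0.
pose n := (Num.truncn (`|j%:~R : R| / d)).+1.
have big : `|j%:~R : R| < `|lam| ^+ n.
  rewrite (_ : `|lam| = 1 + d); last by rewrite /d; ring.
  apply: lt_le_trans (bernoulli_ge _ _); last by lra.
  by rewrite ltr_wpDl// -ltr_pdivrMr// truncnS_gt.
have /intrP[i iE] := jn n.
have i0 : i != 0.
  rewrite -(intr_eq0 R) -iE mulf_neq0 ?intr_eq0//.
  by rewrite invr_eq0 expf_neq0.
have : (1 : R) <= `|i%:~R|.
  by rewrite -intr_norm -[1]/(1%:~R) ler_int -gtz0_ge1 normr_gt0.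
rewrite leNgt -iE normrM normfV normrX mulrC ltr_pdivrMr ?mul1r ?big//.
by rewrite exprn_gt0// (lt_trans ltr01).
Qed.

End Irrationality.

Lemma det_mx2 (A B C D : int) : \det (mx2 A B C D) = A * D - B * C.
Proof.
rewrite (expand_det_row _ 0) !big_ord_recl big_ord0 /cofactor !det_mx11 !mxE/=.
by rewrite expr0 expr1; ring.
Qed.

Theorem theorem1 (R : realType) (A B C D : int) (lam alpha beta : R)
    (n m : int) (hab : alpha + beta = 1) :
  let M : 'M[int]_2 := mx2 A B C D in
  let MR : 'M[R]_2 := map_mx intr M in
  let detM : R := (\det M)%:~R in
  let gamma : R :=
    alpha / (lam - detM) * (n%:~R - (A * C)%:~R / 2)
    + beta / (lam - detM) * (m%:~R - (B * D)%:~R / 2) in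
  let g : slice R :=
    Sub (Heis alpha beta (gamma + alpha * beta / 2))
        (Heis_slice (gamma + alpha * beta / 2) hab) in
  `|\det M| = 1 ->
  eigenvalue MR lam ->
  1 < `|lam| ->
  MR *m cV2 alpha beta = lam *: cV2 alpha beta ->
  [/\ exists2 mu : probability (borel (nilmanifold R)) R,
        haar mu & self_induced mu (niltranslation g),
      minimal (niltranslation g) &
      uniquely_ergodic R (niltranslation g)].
Proof.
move=> M MR detM gamma g detM1 _ lam1 eig.
have detE : \det M = A * D - B * C.
  exact: det_mx2.
have detRE : detM = A%:~R * D%:~R - B%:~R * C%:~R.
  by rewrite /detM detE intrB !intrM.
have det2 : (A%:~R * D%:~R - B%:~R * C%:~R) ^+ 2 = 1 :> R.
  rewrite -detRE /detM -real_normK ?num_real// -intr_norm detM1; exact: expr1n.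
have eig1 : A%:~R * alpha + B%:~R * beta = lam * alpha.
  by have /matrixP/(_ 0 0) := eig; rewrite !mxE big_ord_recl big_ord1 !mxE.
have eig2 : C%:~R * alpha + D%:~R * beta = lam * beta.
  by have /matrixP/(_ 1 0) := eig; rewrite !mxE big_ord_recl big_ord1 !mxE.
have lamdet : lam - detM != 0.
  rewrite subr_eq0; apply: contraTneq lam1 => ->.
  by rewrite /detM -intr_norm detM1 ltxx.
have gammaE : (lam - (A%:~R * D%:~R - B%:~R * C%:~R)) * gamma =
    alpha * (n%:~R - A%:~R * C%:~R / 2) + beta * (m%:~R - B%:~R * D%:~R / 2).
  by rewrite -detRE /gamma !intrM; field.
have irr := eigen_irrational (intr_int _ A) (intr_int _ B) (intr_int _ C) (intr_int _ D)
  det2 lam1 hab eig1 eig2.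
have gE : val g = flow alpha beta gamma 1.
  by rewrite /= /flow !mul1r expr1n mul1r.
have [mu haar_mu muE] := @exists_haar R.
have TF x w : niltranslation g (nilF (x, w)) = nilF (x + alpha, w - x +
    (hz (val g) - alpha + alpha * (alpha - 1) / 2)).
  have := niltranslation_nilF g x w.
  by rewrite -[hx (val g)]/alpha -[hy (val g)]/beta hab /= !mul1r.
have unique := chart_invariant_unique (@nil_chart R) irr TF.
split.
- exists mu => //.
  have intABCD : [/\ (A%:~R : R) \is a Num.int, (B%:~R : R) \is a Num.int,
      (C%:~R : R) \is a Num.int, (D%:~R : R) \is a Num.int &
      (n%:~R : R) \is a Num.int /\ (m%:~R : R) \is a Num.int].
    by split; [| | | |split]; exact: intr_int.
  have ren := aut_renormalization det2 intABCD eig1 eig2 gammaE.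
  have [N [N' [L [L2 renL]]]] := renormalization_large ren lam1.
  have muT := haar_mu g.
  have mA := induced_set_measurable renL.
  apply: (@self_induced_of_conjugacy _ _ (borel (nilmanifold R)) mu (niltranslation g)
    (niltranslation g^-1%g) _ _ _ _ _ _ (expand alpha beta gamma N)
    (contract alpha beta gamma N') (induced_set N' L)) => //.
  + exact: niltranslation_measurable.
  + exact: niltranslation_measurable.
  + exact: niltranslationK.
  + exact: niltranslationVK.
  + by case: muT.
  + by move=> nu nuT B' mB'; exact: unique.
  + exact: (expand_measurable hab renL).
  + exact: (contract_measurable hab renL).
  + exact: (expandK hab renL L2).
  + exact: (induced_set_expand hab renL L2).
  + exact: (contractK hab renL L2).
  + by move=> q; exact: (return_expand hab renL L2 q gE).
  + exact: (induced_set_covers hab renL L2 gE).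
  + exact: (induced_set_disjoint hab renL L2 gE).
- exact: (chart_minimal (@nil_chart R) muE irr TF (haar_mu g)).
- exists mu; first exact: haar_mu.
  by move=> nu nuT B' mB'; exact: unique.
Qed.
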